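(* Let $K\ge1$ and let $\mathbf a=(a_k)_{k\ge1}$ be a sequence of nonnegative real numbers. Consider the edge-reinforced random walk with $K$ walkers on $\mathbb Z$ (as defined in the context) with reinforcement scheme of sequence type given by $\mathbf a$. Set $$\phi(\mathbf a)=\sum_{k=1}^\infty\Bigl(1+\sum_{l=1}^k a_l\Bigr)^{-1}.$$ If $\phi(\mathbf a)=\infty$, then almost surely all walkers are recurrent. If $\phi(\mathbf a)<\infty$, then almost surely all walkers have finite range.
   Context: **Model ($K$ edge-reinforced walkers on $\mathbb Z$).** For $z\in\mathbb Z$, the edge $\{z,z+1\}$ is also denoted by $z$. For every $z\in\mathbb Z$ there is a (deterministic) non-decreasing reinforcement function $W_z:\{0,1,2,\dots\}\to(0,\infty)$. The weight of edge $z$ at time $n$ is $w(n,z)=W_z(c(n,z))$, where $c(n,z)$ is the total number of crossings of the edge $\{z,z+1\}$ by any of the $K$ walkers up to time $n$ (so $c(0,z)=0$). The initial positions $X^{(1)}_0,\dots,X^{(K)}_0\in\mathbb Z$ are arbitrary. At every time step, one of the $K$ walkers is chosen uniformly at random, independently of the history, and only this walker moves. Given the history up to time $n$, if the chosen walker $i$ is at $X^{(i)}_n=z$, it jumps to $z+1$ with probability $\frac{w(n,z)}{w(n,z-1)+w(n,z)}$ and to $z-1$ with probability $\frac{w(n,z-1)}{w(n,z-1)+w(n,z)}$. **Sequence type.** The reinforcement is of sequence type, given by $\mathbf a=(a_k)_{k\ge1}$ with $a_k\ge0$, if $W_z(k)=1+\sum_{l=1}^k a_l$ for all edges $z\in\mathbb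 Z$ and all $k\ge0$. In particular all initial edge weights are $1$. **Terminology.** Walker $i$ is *recurrent* if every integer appears infinitely often in the sequence $(X^{(i)}_n)_{n\ge0}$; it has *finite range* if only finitely many distinct integers appear in the sequence $(X^{(i)}_n)_{n\ge0}$. *)

(* Defs.v *)
From mathcomp Require Import all_boot all_order all_algebra.
From mathcomp Require Import all_classical all_reals all_analysis.

Set Implicit Arguments.
Unset Strict Implicit.
Unset Printing Implicit Defensive.

Import Order.TTheory GRing.Theory Num.Theory.
Local Open Scope classical_set_scope.
Local Open Scope ring_scope.

(* The edge {z, z+1} of the integer line is identified with z, and W z k is the
   weight of the edge z once it has been crossed k times. *)
Definition reinforcement (R : realType) (W : int -> nat -> R) : Prop :=
  (forall z k, 0 < W z k) /\ (forall z, {homo W z : k l / (k <= l)%N >-> k <= l}).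

(* The term a 0 is never used: sequences are indexed by k >= 1. *)
Definition seq_reinf (R : realType) (a : nat -> R) : int -> nat -> R :=
  fun=> fun k => 1 + \sum_(1 <= l < k.+1) a l.

Lemma seq_reinfP (R : realType) (a : nat -> R) :
  (forall k, (1 <= k)%N -> 0 <= a k) -> reinforcement (seq_reinf a).
Proof.
move=> a0; split=> [z k|z k l kl]; rewrite /seq_reinf.
  rewrite ltr_pwDl// big_nat_cond sumr_ge0// => i /andP[/andP[i1 _] _].
  exact: a0.
rewrite lerD2l (@big_cat_nat _ _ _ k.+1 1 l.+1)//= lerDl.
rewrite big_nat_cond sumr_ge0// => i /andP[/andP[ki _] _].
by apply: a0; apply: leq_trans ki.
Qed.

Definition phi (R : realType) (a : nat -> R) : \bar R :=
  (\sum_(1 <= k <oo) ((1 + \sum_(1 <= l < k.+1) a l)^-1)%:E)%E.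

Definition crosses (z x y : int) : bool :=
  ((x == z) && (y == z + 1)) || ((x == z + 1) && (y == z)).

(* h i m is the position of walker i at time m *)
Definition crossings K (h : 'I_K -> nat -> int) (n : nat) (z : int) : nat :=
  (\sum_(m < n) \sum_(i < K) crosses z (h i m) (h i m.+1))%N.

Definition weight (R : realType) (W : int -> nat -> R) K
    (h : 'I_K -> nat -> int) (n : nat) (z : int) : R :=
  W z (crossings h n z).

Definition history (T : Type) K (X : 'I_K -> nat -> T -> int)
    (chosen : nat -> T -> 'I_K) (n : nat)
    (h : 'I_K -> nat -> int) (c : nat -> 'I_K) : set T :=
  [set w | (forall i m, (m <= n)%N -> X i m w = h i m) /\
           (forall m, (m < n)%N -> chosen m w = c m)].

(* X i n is the position of walker i at time n, and chosen n is the walker that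
   moves between times n and n+1. There are only countably many histories up to
   time n, so the conditional laws are given by elementary conditioning on each
   of them, in the product form P(H and A) = P(H) * p, which is void if
   P(H) = 0. *)
Record errw d (T : measurableType d) (R : realType) (P : probability T R) K
    (W : int -> nat -> R) (x0 : 'I_K -> int)
    (X : 'I_K -> nat -> T -> int) (chosen : nat -> T -> 'I_K) : Prop := Errw {
  errw_measurable : forall i n z, measurable [set w | X i n w = z] ;
  errw_measurable_chosen : forall n i, measurable [set w | chosen n w = i] ;
  errw_init : {ae P, forall w, forall i, X i 0%N w = x0 i} ;
  errw_unchosen : {ae P, forall w, forall n j,
    j != chosen n w -> X j n.+1 w = X j n w} ;
  errw_chosen : forall n h c i,
    P (history X chosen n h c `&` [set w | chosen n w = i]) =
    (P (history X chosen n h c) * (K%:R^-1)%:E)%E ;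
  errw_right : forall n h c i, let z := h i n in
    P (history X chosen n h c `&` [set w | chosen n w = i]
         `&` [set w | X i n.+1 w = z + 1]) =
    (P (history X chosen n h c `&` [set w | chosen n w = i]) *
     (weight W h n z / (weight W h n (z - 1) + weight W h n z))%:E)%E ;
  errw_left : forall n h c i, let z := h i n in
    P (history X chosen n h c `&` [set w | chosen n w = i]
         `&` [set w | X i n.+1 w = z - 1]) =
    (P (history X chosen n h c `&` [set w | chosen n w = i]) *
     (weight W h n (z - 1) / (weight W h n (z - 1) + weight W h n z))%:E)%E
}.

Definition recurrent (x : nat -> int) : Prop :=
  forall z, infinite_set [set n | x n = z].

Definition finite_range (x : nat -> int) : Prop := finite_set (range x).

(* Main.v *)
(* The positions of the walkers and the crossing numbers of the edges form a Markov
   chain driven by finitely many moves, and everything follows from Ville's maximal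
   inequality for nonnegative supermartingales along the tree of moves.

   With w the current weights, the resistance sum_{y <= z < X_i} 1/w(z) between y and
   walker i is a supermartingale while X_i > y. Hence a walker which crosses infinitely
   many fresh edges to the right comes back below every y: otherwise its resistance
   would stay bounded and make infinitely many jumps of size 1/w(1).

   If phi(a) < oo, such a walker gets trapped: after each fresh crossing, it crosses the
   next edge and then only that edge with probability bounded below, as the crossings
   of a single edge make its weight summably dominant. So the range is bounded.

   If phi(a) = oo, an edge crossed infinitely often transmits this to its neighbours, so
   the range cannot be bounded, and there are walkers which are infinitely often the
   rightmost, respectively the leftmost one, and visit everything. A walker j confined
   below r would meet the leftmost explorer k infinitely often. At each meeting the
   exchange of j and k leaves the state unchanged, so k is the first of the two to pass
   r with probability at most 1/2, and j cannot lose all of these races. *)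

Require Import Defs.
From mathcomp Require Import all_boot all_order all_algebra.
From mathcomp Require Import all_classical all_reals all_analysis.
From mathcomp Require Import perm zify ring lra.
Import Order.TTheory GRing.Theory Num.Theory.
Import numFieldNormedType.Exports.
Local Open Scope classical_set_scope.
Local Open Scope ring_scope.

Set Implicit Arguments.
Unset Strict Implicit.
Unset Printing Implicit Defensive.

(** * The Markov chain of positions and crossing numbers *)

Section Chain.
Context (R : realType) (K : nat).

(* Positions of the walkers and numbers of crossings of the edges: together they
   form a Markov chain, driven by moves (walker, direction), where [true] means
   to the right. *)
Definition state := (('I_K -> int) * (int -> nat))%type.
Definition jump := ('I_K * bool)%type.
Implicit Types (x : state) (e : jump).

Definition target (e : jump) (p : int) : int := if e.2 then p + 1 else p - 1.

Definition edge x e : int := if e.2 then x.1 e.1 else x.1 e.1 - 1.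

Definition step x e : state :=
  (fun j => if j == e.1 then target e (x.1 j) else x.1 j,
   fun z => (x.2 z + (z == edge x e))%N).

Definition pr (W : nat -> R) x (i : 'I_K) : R :=
  W (x.2 (x.1 i)) / (W (x.2 (x.1 i - 1)) + W (x.2 (x.1 i))).

Definition pl (W : nat -> R) x (i : 'I_K) : R :=
  W (x.2 (x.1 i - 1)) / (W (x.2 (x.1 i - 1)) + W (x.2 (x.1 i))).

Definition jump_prob (W : nat -> R) x e : R :=
  K%:R^-1 * (if e.2 then pr W x e.1 else pl W x e.1).

Lemma sum_jump (g : jump -> R) : \sum_e g e = \sum_i (g (i, true) + g (i, false)).
Proof.
rewrite (eq_bigr (fun e => g (e.1, e.2))); last by case.
rewrite -(pair_bigA _ (fun i b => g (i, b))) /=.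
by apply: eq_bigr => i _; rewrite big_bool.
Qed.

Lemma sum_jump_prob (W : nat -> R) x (g : jump -> R) :
  \sum_e jump_prob W x e * g e =
  K%:R^-1 * \sum_i (pr W x i * g (i, true) + pl W x i * g (i, false)).
Proof.
rewrite sum_jump mulr_sumr; apply: eq_bigr => i _.
by rewrite /jump_prob /= mulrDr !mulrA.
Qed.

Section weights.
Context (W : nat -> R) (W0 : forall k, 0 < W k).

Lemma pr_ge0 x i : 0 <= pr W x i.
Proof. by rewrite divr_ge0// ?addr_ge0// ltW. Qed.

Lemma pl_ge0 x i : 0 <= pl W x i.
Proof. by rewrite divr_ge0// ?addr_ge0// ltW. Qed.

Lemma prDpl x i : pr W x i + pl W x i = 1.
Proof. by rewrite -mulrDl addrC divff// gt_eqF// addr_gt0. Qed.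

Lemma plE x i : pl W x i = 1 - pr W x i.
Proof. by rewrite -(prDpl x i); ring. Qed.

Lemma jump_prob_ge0 x e : 0 <= jump_prob W x e.
Proof.
by rewrite mulr_ge0// ?invr_ge0//; case: e.2; [exact: pr_ge0|exact: pl_ge0].
Qed.

(** The moving walker is uniform, so it suffices to bound the mean over the direction for each
    walker separately. The condition [0 <= r] covers [K = 0], where the sum is empty. *)
Lemma sum_jump_prob_le x (g : jump -> R) (r : R) : 0 <= r ->
  (forall i, pr W x i * g (i, true) + pl W x i * g (i, false) <= r) ->
  \sum_e jump_prob W x e * g e <= r.
Proof.
move=> r0 gr; rewrite sum_jump_prob.
apply: (@le_trans _ _ (K%:R^-1 * \sum_(i < K) r)).
  by rewrite ler_wpM2l ?invr_ge0// ler_sum.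
rewrite sumr_const card_ord -[r *+ K]mulr_natl mulrA.
have [->|K0] := posnP K; first by rewrite mulr0 mul0r.
by rewrite mulVf ?mul1r// pnatr_eq0 -lt0n.
Qed.

End weights.

Lemma step_pos x e j : (step x e).1 j = if j == e.1 then target e (x.1 j) else x.1 j.
Proof. by []. Qed.

Lemma step_posE x e : (step x e).1 e.1 = target e (x.1 e.1).
Proof. by rewrite /= eqxx. Qed.

Lemma step_cnt x e z : (step x e).2 z = (x.2 z + (z == edge x e))%N.
Proof. by []. Qed.

Lemma eq_crossings (h h' : 'I_K -> nat -> int) n z :
  (forall i m, (m <= n)%N -> h i m = h' i m) -> crossings h n z = crossings h' n z.
Proof.
move=> hh'; apply: eq_bigr => m _; apply: eq_bigr => i _.
by rewrite !hh'// ltnW.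
Qed.

Lemma crosses_step x e z :
  (\sum_(i < K) crosses z (x.1 i) ((step x e).1 i))%N = (z == edge x e).
Proof.
rewrite (bigD1 e.1)//= big1 ?addn0 => [|i /negPf ie].
  rewrite eqxx /crosses /target /edge; case: e => i [] /=; congr nat_of_bool; lia.
by rewrite ie /crosses; apply/eqP; rewrite eqb0; lia.
Qed.

Lemma crossingsS (h : 'I_K -> nat -> int) n z :
  crossings h n.+1 z = (crossings h n z + \sum_(i < K) crosses z (h i n) (h i n.+1))%N.
Proof. by rewrite /crossings big_ord_recr. Qed.

Lemma crossings_step (x : nat -> state) n z :
  (forall z, (x 0%N).2 z = 0%N) ->
  (forall m, (m < n)%N -> exists e, x m.+1 = step (x m) e) ->
  crossings (fun i m => (x m).1 i) n z = (x n).2 z.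
Proof.
move=> x0; elim: n => [_|n ih xn]; first by rewrite /crossings big_ord0 x0.
rewrite crossingsS ih; last first.
  by move=> m mn; apply: xn; exact: ltnW.
by have [e ->] := xn n (ltnSn n); rewrite crosses_step.
Qed.


(** * Cylinder events along the tree of moves *)

Section Tree.
Context (W : nat -> R) (W0 : forall k, 0 < W k).
Context d (T : measurableType d) (P : probability T R).
Context (x0 : 'I_K -> int) (X : 'I_K -> nat -> T -> int) (chosen : nat -> T -> 'I_K).
Hypothesis hX : errw P (fun=> W) x0 X chosen.
Context (i0 : 'I_K).

Definition start : state := (x0, fun=> 0%N).

Definition valid (x : nat -> state) :=
  x 0%N = start /\ forall n, exists e, x n.+1 = step (x n) e.

Definition node (s : seq jump) : state := foldl step start s.

(** Phrased through [history], so that the conditional laws in [errw] apply literally. The default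
    of [nth] is never reached, as only [m < size s] matters. *)
Definition cyl (s : seq jump) : set T :=
  history X chosen (size s) (fun i m => (node (take m s)).1 i)
    (fun m => (nth (i0, true) s m).1).

Definition traj (w : T) (n : nat) : state :=
  (fun i => X i n w, crossings (fun i m => X i m w) n).

Lemma node_rcons s e : node (rcons s e) = step (node s) e.
Proof. by rewrite /node -cats1 foldl_cat. Qed.

Lemma node_takeS s m : (m < size s)%N ->
  node (take m.+1 s) = step (node (take m s)) (nth (i0, true) s m).
Proof. by move=> ms; rewrite (take_nth (i0, true) ms) node_rcons. Qed.

Lemma node_cnt s z :
  crossings (fun i m => (node (take m s)).1 i) (size s) z = (node s).2 z.
Proof.
rewrite (@crossings_step (fun m => node (take m s)))//; first by rewrite take_size.
  by rewrite take0.
by move=> m ms; exists (nth (i0, true) s m); rewrite node_takeS.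
Qed.

Lemma cylE s w : cyl s w -> traj w (size s) = node s.
Proof.
move=> [sX _]; rewrite [RHS]surjective_pairing.
apply/pair_equal_spec; split; first by apply/funext => i; rewrite sX// take_size.
by apply/funext => z; rewrite -node_cnt; apply: eq_crossings => i m ms; rewrite sX.
Qed.

Lemma cyl_rconsE s e : cyl (rcons s e) = cyl s `&`
  [set w | chosen (size s) w = e.1] `&`
  [set w | forall j, X j (size s).+1 w = (step (node s) e).1 j].
Proof.
have tk m : (m <= size s)%N -> take m (rcons s e) = take m s.
  by move=> ms; rewrite -cats1 takel_cat.
have nt m : (m < size s)%N -> nth (i0, true) (rcons s e) m = nth (i0, true) s m.
  by move=> ms; rewrite nth_rcons ms.
apply/seteqP; split => w; rewrite /cyl /history /= size_rcons => -[].
  move=> sX sc; split; [split; [split|]|].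
  - by move=> i m ms; rewrite sX ?tk// ltnW.
  - by move=> m ms; rewrite sc ?nt// ltnW.
  - by rewrite sc// nth_rcons ltnn eqxx.
  - by move=> j; rewrite sX// -[X in take X _](size_rcons s e) take_size node_rcons.
move=> [[sX sc] ce] Xe; split.
  move=> i m; rewrite leq_eqVlt => /orP[/eqP->|ms]; last by rewrite sX ?tk.
  by rewrite Xe -[X in take X _](size_rcons s e) take_size node_rcons.
move=> m; rewrite ltnS leq_eqVlt => /orP[/eqP->|ms]; last by rewrite sc ?nt.
by rewrite nth_rcons ltnn eqxx.
Qed.

Lemma measurable_forall_ord n (A : 'I_n -> set T) : (forall i, measurable (A i)) ->
  measurable [set w | forall i, A i w].
Proof.
move=> mA; rewrite (_ : [set w | _] = \bigcap_(i in [set: 'I_n]) A i).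
  by apply: fin_bigcap_measurable.
by apply/seteqP; split => w Aw i //; exact: Aw.
Qed.

Lemma measurable_cyl s : measurable (cyl s).
Proof.
elim/last_ind: s => [|s e ih].
  rewrite (_ : cyl [::] = [set w | forall i, X i 0%N w = x0 i]).
    by apply: measurable_forall_ord => i; exact: (errw_measurable hX).
  apply/seteqP; split => w; rewrite /cyl /history /=.
    by move=> [sX _] i; rewrite sX.
  by move=> sX; split => // i m; rewrite leqn0 => /eqP ->; rewrite sX.
rewrite cyl_rconsE; apply: measurableI; first apply: measurableI => //.
  exact: (errw_measurable_chosen hX).
by apply: measurable_forall_ord => i; exact: (errw_measurable hX).
Qed.

Lemma measure_ae_le (A B : set T) : measurable A -> measurable B ->
  {ae P, forall w, A w -> B w} -> (P A <= P B)%E.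
Proof.
move=> mA mB [N [mN N0 AB]].
apply: (@le_trans _ _ (P (B `|` N))).
  rewrite le_measure ?inE//; first exact: measurableU.
  move=> w Aw; have [Bw|nBw] := pselect (B w); [by left|right].
  by apply: AB => /= /(_ Aw).
have {}N0 : (P N <= 0)%E by rewrite N0.
by rewrite (le_trans (measureU2 _ _ _))// -[leRHS]adde0 leeD2l.
Qed.

(** The longer cylinder fixes all new positions, whereas [errw] gives the law of the mover only.
    Almost surely the other walkers stay put, so the event [B] on the mover alone has the same
    probability. *)
Lemma cyl_rcons s e : P (cyl (rcons s e)) = (P (cyl s) * (jump_prob W (node s) e)%:E)%E.
Proof.
set h := fun i m => (node (take m s)).1 i.
set c := fun m => (nth (i0, true) s m).1.
have hs i : h i (size s) = (node s).1 i by rewrite /h take_size.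
have hw z : weight (fun=> W) h (size s) z = W ((node s).2 z).
  by rewrite /weight node_cnt.
pose B := cyl s `&` [set w | chosen (size s) w = e.1] `&`
  [set w | X e.1 (size s).+1 w = target e ((node s).1 e.1)].
have mB : measurable B.
  apply: measurableI; first apply: measurableI; first exact: measurable_cyl.
    exact: (errw_measurable_chosen hX).
  exact: (errw_measurable hX).
transitivity (P B).
  apply/eqP; rewrite eq_le; apply/andP; split.
    apply: le_measure; rewrite ?inE//; first exact: measurable_cyl.
    by rewrite cyl_rconsE => w [ws wX]; split=> //=; rewrite wX step_posE.
  apply: measure_ae_le => //; first exact: measurable_cyl.
  apply: filterS (errw_unchosen hX) => w wu [[ws /= wc] wX].
  rewrite cyl_rconsE; split=> // j /=; case: eqVneq => [->//|je].
  by rewrite wu ?wc// -(hs j) ws.1.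
rewrite /B /cyl.
case: e {B mB} => i [] /=; rewrite /target/=.
- have := errw_right hX (size s) h c i; rewrite /= hs => ->.
  by rewrite (errw_chosen hX) !hw -muleA -EFinM.
- have := errw_left hX (size s) h c i; rewrite /= hs => ->.
  by rewrite (errw_chosen hX) !hw -muleA -EFinM.
Qed.
Lemma ae_forall_count (I : countType) (Q : I -> T -> Prop) :
  (forall i, {ae P, forall w, Q i w}) -> {ae P, forall w, forall i, Q i w}.
Proof.
move=> aQ; pose Q' n w := if unpickle n is Some i then Q i w else True.
have : {ae P, forall w, forall n, Q' n w}.
  apply: ae_foralln => n; rewrite /Q'; case: unpickle => [i|]; first exact: aQ.
  exact: aeW.
by apply: filterS => w Qw i; have := Qw (pickle i); rewrite /Q' pickleK.
Qed.

Lemma cyl_rcons_disjoint s e e' w :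
  cyl (rcons s e) w -> cyl (rcons s e') w -> e = e'.
Proof.
rewrite !cyl_rconsE => -[[_ /= c] Xe] [[_ /= c'] Xe'].
case: e c Xe => i b /= ci Xe; case: e' c' Xe' => i' b' /= ci' Xe'.
have ii' : i = i' by rewrite -ci -ci'.
rewrite -ii' {ci' ii'} in Xe' *; congr (_, _).
have := Xe i; rewrite Xe' /= eqxx /target/=.
by case: b {Xe} => /=; case: b' {Xe'} => //=; lia.
Qed.

Lemma sum_jump_prob1 x : \sum_e jump_prob W x e = 1.
Proof.
transitivity (\sum_e jump_prob W x e * 1); first by apply: eq_bigr => e _; rewrite mulr1.
rewrite sum_jump_prob (eq_bigr (fun=> 1)).
  rewrite sumr_const card_ord mulVf// pnatr_eq0 -lt0n.
  by case: (K) i0 => // -[].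
by move=> i _; rewrite !mulr1 prDpl.
Qed.

(** The one-move extensions of a cylinder are disjoint, and their probabilities add up to its own
    because the jump probabilities sum to 1. There are countably many cylinders, so the null sets
    can be united. *)
Lemma cyl_next :
  {ae P, forall w, forall s, cyl s w -> exists e, cyl (rcons s e) w}.
Proof.
apply: ae_forall_count => s.
pose U := \bigcup_(e in [set: jump]) cyl (rcons s e).
have finJ : finite_set [set: jump] by exact: (@finite_finset ('I_K * bool)%type).
have mU : measurable U.
  by apply: fin_bigcup_measurable => // e _; exact: measurable_cyl.
exists (cyl s `\` U); split.
- by apply: measurableD => //; exact: measurable_cyl.
- rewrite measureD//; last 2 first.
  + exact: measurable_cyl.
  + by rewrite ltey_eq fin_num_measure//; exact: measurable_cyl.
  rewrite setIidr; last by move=> w [e _]; rewrite cyl_rconsE => -[[]].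
  rewrite /U measure_fin_bigcup//.
  + rewrite (_ : [set: jump] = [set` index_enum jump]); last first.
      by apply/seteqP; split => // e _ /=; rewrite mem_index_enum.
    rewrite -fsbig_seq ?index_enum_uniq//.
    rewrite (eq_bigr (fun e => P (cyl s) * (jump_prob W (node s) e)%:E)%E); last first.
      by move=> e _; exact: cyl_rcons.
    rewrite -ge0_sume_distrr; last by move=> e _; rewrite lee_fin jump_prob_ge0.
    rewrite sumEFin sum_jump_prob1 mule1 subee// fin_num_measure//.
    exact: measurable_cyl.
  + move=> e e' _ _ [w [we we']]; exact: cyl_rcons_disjoint we we'.
  + by move=> e _; exact: measurable_cyl.
- move=> w /= /not_implyP [sw nw]; split => // -[e _ we].
  by apply: nw; exists e.
Qed.

(** The path is consumed from its beginning, to match the recursion of [hit]; [runS] recovers the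
    recursion at the last step. *)
Fixpoint run (M : Type) (upd : M -> state -> state -> M) (m : M) (x : nat -> state)
    (n : nat) : M :=
  if n is n'.+1 then run upd (upd m (x 0%N) (x 1%N)) (fun k => x k.+1) n' else m.

Lemma runS (M : Type) (upd : M -> state -> state -> M) m (x : nat -> state) n :
  run upd m x n.+1 = upd (run upd m x n) (x n) (x n.+1).
Proof.
elim: n m x => [//|n ih] m x.
exact: (ih (upd m (x 0%N) (x 1%N)) (fun k => x k.+1)).
Qed.

(** * Ville's maximal inequality *)

Section Ville.
Context (M : Type) (upd : M -> state -> state -> M) (Inv : M -> state -> Prop).
Context (f : M -> state -> R).
Hypothesis f_ge0 : forall m x, Inv m x -> 0 <= f m x.
Hypothesis Inv_step : forall m x e, Inv m x -> Inv (upd m x (step x e)) (step x e).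
Hypothesis f_super : forall m x, Inv m x ->
  \sum_e jump_prob W x e * f (upd m x (step x e)) (step x e) <= f m x.

(* f reaches the level r within k moves after the node s, the memory being m at s. *)
Fixpoint hit (r : R) (k : nat) (s : seq jump) (m : M) : set T :=
  if r <= f m (node s) then cyl s else
  if k is k'.+1 then
    \big[setU/set0]_(e : jump) hit r k' (rcons s e) (upd m (node s) (node (rcons s e)))
  else set0.

Lemma measurable_hit r k s m : measurable (hit r k s m).
Proof.
elim: k s m => [|k ih] s m /=; case: ifP => _ //; try exact: measurable_cyl.
by apply: bigsetU_measurable => e _; exact: ih.
Qed.

Lemma measure_bigsetU_le (I : Type) (r : seq I) (A : I -> set T) :
  (forall i, measurable (A i)) ->
  (P (\big[setU/set0]_(i <- r) A i) <= \sum_(i <- r) P (A i))%E.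
Proof.
move=> mA; elim: r => [|i r ih]; first by rewrite !big_nil measure0.
rewrite !big_cons; apply: le_trans (leeD2l _ ih).
by apply: measureU2 => //; exact: bigsetU_measurable.
Qed.

(** Induction on the horizon: at a node where [f] is below [r], the bounds for the children add up,
    by [cyl_rcons] and the drift condition, to the bound for the node. *)
Lemma hit_le r k s m : 0 < r -> Inv m (node s) ->
  (r%:E * P (hit r k s m) <= P (cyl s) * (f m (node s))%:E)%E.
Proof.
move=> r0; elim: k s m => [|k ih] s m im /=; case: ifPn => rf.
- by rewrite muleC lee_wpmul2l// lee_fin.
- by rewrite measure0 mule0 mule_ge0// lee_fin f_ge0.
- by rewrite muleC lee_wpmul2l// lee_fin.
- apply: (@le_trans _ _ (\sum_(e : jump) r%:E *
      P (hit r k (rcons s e) (upd m (node s) (node (rcons s e)))))%E).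
    rewrite -ge0_sume_distrr//; apply: lee_wpmul2l; first by rewrite lee_fin ltW.
    by apply: measure_bigsetU_le => e; exact: measurable_hit.
  apply: (@le_trans _ _ (\sum_(e : jump) P (cyl s) *
     (jump_prob W (node s) e *
      f (upd m (node s) (step (node s) e)) (step (node s) e))%:E)%E).
    apply: lee_sum => e _; apply: (le_trans (ih _ _ _)).
      by rewrite node_rcons; exact: Inv_step.
    by rewrite node_rcons EFinM muleA; rewrite -cyl_rcons.
  rewrite -ge0_sume_distrr; last first.
    by move=> e _; rewrite lee_fin mulr_ge0 ?jump_prob_ge0// f_ge0//; exact: Inv_step.
  by rewrite lee_wpmul2l// sumEFin lee_fin f_super.
Qed.

Lemma bigsetUP (A : jump -> set T) w :
  (\big[setU/set0]_(e : jump) A e) w <-> exists e, A e w.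
Proof.
rewrite -bigcup_seq; split=> [[e _ Aw]|[e Aw]]; exists e => //=.
by rewrite mem_index_enum.
Qed.

Lemma hitS r k s m : hit r k s m `<=` hit r k.+1 s m.
Proof.
elim: k s m => [|k ih] s m w; rewrite [hit _ _.+1]lock /= -lock.
  by rewrite /=; case: ifP.
rewrite [X in _ -> X]/=; case: ifP => // _ /bigsetUP[e we]; apply/bigsetUP.
by exists e; exact: ih.
Qed.

(** Level r+1 is reached within k moves with probability at most c/(r+1), hence also at any time, by
    continuity along increasing k. Reaching all levels then has probability at most c/(r+1) for
    every r. *)
Lemma hit_negligible s m : Inv m (node s) ->
  P.-negligible (\bigcap_(r in [set: nat]) \bigcup_k hit r.+1%:R k s m).
Proof.
move=> im; set U := fun r : nat => \bigcup_k hit r.+1%:R k s m.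
have mU r : measurable (U r) by apply: bigcupT_measurable => k; exact: measurable_hit.
have mI : measurable (\bigcap_(r in [set: nat]) U r) by exact: bigcapT_measurable.
apply/negligibleP => //; set p := (X in X = _).
pose c := fine (P (cyl s)) * f m (node s).
have Ph r k : (P (hit r.+1%:R k s m) <= (r.+1%:R^-1 * c)%:E)%E.
  rewrite EFinM lee_pdivlMl// /c EFinM fineK ?fin_num_measure//; last exact: measurable_cyl.
  exact: hit_le.
have PU r : (P (U r) <= (r.+1%:R^-1 * c)%:E)%E.
  have cv : P (hit r.+1%:R k s m) @[k --> \oo] --> P (U r).
    apply: nondecreasing_cvg_mu; first by move=> k; exact: measurable_hit.
      exact: mU.
    by apply/nondecreasing_seqP => k; apply/subsetPset; exact: hitS.
  by rewrite -(cvg_lim _ cv)//; apply: lime_le; [apply/cvg_ex; eexists; exact: cv|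
    exact: nearW].
have pfin : p \is a fin_num by rewrite fin_num_measure.
have p_le r : r.+1%:R * fine p <= c.
  rewrite -ler_pdivlMl// -lee_fin fineK// (le_trans _ (PU r))//.
  by rewrite le_measure ?inE// => w; apply.
have : (0 <= p)%E by exact: measure_ge0.
rewrite le_eqVlt => /orP[/eqP //|p0].
have {}p0 : 0 < fine p by rewrite fine_gt0// p0 ltey_eq pfin.
have := p_le (Num.bound (c / fine p)); rewrite leNgt -ltr_pdivrMr//.
have c0 : 0 <= c by rewrite mulr_ge0 ?fine_ge0// f_ge0.
rewrite (@lt_le_trans _ _ (Num.bound (c / fine p))%:R)//; last by rewrite ler_nat.
by rewrite archi_boundP// divr_ge0// ltW.
Qed.

(** Passage from paths to the tree: a path on which [f] is at least [r] after k moves lies in the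
    tree event, possibly because that level was reached earlier. *)
Lemma hitP r k s m w :
  (forall s, cyl s w -> exists e, cyl (rcons s e) w) -> cyl s w ->
  r <= f (run upd m (fun n => traj w (size s + n)) k) (traj w (size s + k)) ->
  hit r k s m w.
Proof.
move=> nx; elim: k s m => [|k ih] s m sw /=.
  by rewrite addn0 (cylE sw) => ->.
case: ifP => // _ rf; have [e we] := nx _ sw.
apply/bigsetUP; exists e; apply: ih => //.
rewrite size_rcons -(cylE sw) -(cylE we) size_rcons.
move: rf; rewrite addn0 addn1 addnS -addSn.
by under [X in run _ _ X k]eq_fun do rewrite addnS -addSn.
Qed.

End Ville.

(** The memory lets [f] depend on the past, and [Inv] restricts the drift condition to the pairs
    that can occur. The path up to time [n0] follows one of countably many cylinders, and
    [hit_negligible] applies to each of them. *)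
Theorem supermartingale_bounded (M : Type) (upd : M -> state -> state -> M)
    (Inv : M -> state -> Prop) (f : M -> state -> R) (m0 : state -> M) (n0 : nat) :
  (forall m x, Inv m x -> 0 <= f m x) ->
  (forall m x e, Inv m x -> Inv (upd m x (step x e)) (step x e)) ->
  (forall m x, Inv m x ->
    \sum_e jump_prob W x e * f (upd m x (step x e)) (step x e) <= f m x) ->
  {ae P, forall w, Inv (m0 (traj w n0)) (traj w n0) -> exists L, forall n,
    f (run upd (m0 (traj w n0)) (fun n => traj w (n0 + n)) n) (traj w (n0 + n)) <= L}.
Proof.
move=> f0 If fs.
have nN : {ae P, forall w, forall s, Inv (m0 (node s)) (node s) ->
    ~ (\bigcap_(r in [set: nat]) \bigcup_k hit upd f r.+1%:R k s (m0 (node s))) w}.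
  apply: ae_forall_count => s.
  have [im|nim] := pselect (Inv (m0 (node s)) (node s)); last exact: aeW.
  have := hit_negligible f0 If fs im; apply: negligibleS => w /= nw.
  by apply: contrapT => h; apply: nw.
near=> w => iw.
have nx : forall s, cyl s w -> exists e, cyl (rcons s e) w by near: w; exact: cyl_next.
have [s [sn sw]] : exists s, size s = n0 /\ cyl s w.
  elim: n0 {iw} => [|n [s [sn sw]]].
    exists [::]; split => //; split => // i m; rewrite leqn0 => /eqP -> /=.
    by move: i; near: w; exact: (errw_init hX).
  by have [e we] := nx _ sw; exists (rcons s e); rewrite size_rcons sn.
have sE := cylE sw; rewrite sn in sE; rewrite sE in iw *.
have : ~ (\bigcap_(r in [set: nat]) \bigcup_k hit upd f r.+1%:R k s (m0 (node s))) w.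
  by move: s {sn sw sE} iw; near: w.
apply: contra_notP => nL r _.
have /existsNP[k /negP] : ~ forall n, f (run upd (m0 (node s)) (fun n => traj w (n0 + n)) n)
    (traj w (n0 + n)) <= r.+1%:R by move=> h; apply: nL; exists r.+1%:R.
rewrite -ltNge => /ltW rf; exists k => //.
by apply: hitP => //; rewrite sn.
Unshelve. all: by end_near. Qed.

Corollary supermartingale_bounded_walkerwise (M : Type) (upd : M -> state -> state -> M)
    (Inv : M -> state -> Prop) (f : M -> state -> R) (m0 : state -> M) (n0 : nat) :
  (forall m x, Inv m x -> 0 <= f m x) ->
  (forall m x e, Inv m x -> Inv (upd m x (step x e)) (step x e)) ->
  (forall m x i, Inv m x ->
    pr W x i * f (upd m x (step x (i, true))) (step x (i, true)) +
    pl W x i * f (upd m x (step x (i, false))) (step x (i, false)) <= f m x) ->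
  {ae P, forall w, Inv (m0 (traj w n0)) (traj w n0) -> exists L, forall n,
    f (run upd (m0 (traj w n0)) (fun n => traj w (n0 + n)) n) (traj w (n0 + n)) <= L}.
Proof.
move=> f0 If fs; refine (supermartingale_bounded m0 n0 f0 If _) => m x im.
by apply: sum_jump_prob_le => //; [exact: f0|move=> i; exact: fs].
Qed.

(** By [cyl_next], almost every path can be followed move by move from the root. The deterministic
    arguments on paths rest on this property. *)
Lemma traj_valid : {ae P, forall w, valid (traj w)}.
Proof.
near=> w.
have nx : forall s, cyl s w -> exists e, cyl (rcons s e) w by near: w; exact: cyl_next.
have w0 : cyl [::] w.
  split => // i m; rewrite leqn0 => /eqP -> /=.
  by move: i; near: w; exact: (errw_init hX).
split; first by rewrite -[0%N]/(size (@nil jump)) (cylE w0).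
have cn n : exists s, size s = n /\ cyl s w.
  elim: n => [|n [s [sn sw]]]; first by exists [::].
  by have [e we] := nx _ sw; exists (rcons s e); rewrite size_rcons sn.
move=> n; have [s [sn sw]] := cn n; have [e we] := nx _ sw; exists e.
by rewrite -sn -[X in traj w X](size_rcons s e) (cylE we) (cylE sw) node_rcons.
Unshelve. all: by end_near. Qed.

End Tree.

End Chain.

(** * Paths of the chain *)

Section Paths.
Context (K : nat) (x0 : 'I_K -> int) (x : nat -> state K).

Hypothesis vx : valid x0 x.

Definition fresh (i : 'I_K) (y : int) (n : nat) :=
  [/\ (x n.+1).1 i = (x n).1 i + 1, (x n).2 ((x n).1 i) = 0%N & y <= (x n).1 i].

Definition explores i := forall y n0, exists2 n, (n0 <= n)%N & fresh i y n.

Lemma pos_lip n i : (x n).1 i - 1 <= (x n.+1).1 i <= (x n).1 i + 1.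
Proof.
have [e ->] := vx.2 n; rewrite step_pos; case: ifP => _; rewrite /target; last by lia.
by case: e.2; lia.
Qed.

Lemma cnt_mono z m n : (m <= n)%N -> ((x m).2 z <= (x n).2 z)%N.
Proof.
move=> /subnK <-; elim: (n - m)%N => [//|k ih]; rewrite addSn.
by have [e ->] := vx.2 (k + m)%N; rewrite step_cnt (leq_trans ih)// leq_addr.
Qed.

Lemma pos_le (y0 : int) n i : (forall i, x0 i <= y0) -> (x n).1 i <= y0 + n%:Z.
Proof.
move=> xy; elim: n => [|n ih]; first by rewrite vx.1 /= addr0.
by have := pos_lip n i; lia.
Qed.

(* Beyond a never crossed edge to the right of all starting points, everything
   is untouched. *)
Definition frontier (y0 : int) (s : state K) := forall z, y0 <= z -> s.2 z = 0%N ->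
  (forall j, s.1 j <= z) /\ (forall z', z <= z' -> s.2 z' = 0%N).

Lemma frontier_step y0 s e : frontier y0 s -> frontier y0 (step s e).
Proof.
move=> fs z yz; rewrite step_cnt => /eqP; rewrite addn_eq0 => /andP[/eqP sz].
rewrite eqb0 => ze; have [ps cs] := fs z yz sz; split.
  move=> j; rewrite step_pos; have := ps j; case: eqVneq => // ->.
  move: ze; rewrite /target /edge; case: e.2; lia.
move=> z' zz'; rewrite step_cnt cs//; have := ps e.1.
by move: ze; rewrite /edge; case: e.2; case: eqVneq => //; lia.
Qed.

Lemma frontierP (y0 : int) n : (forall i, x0 i <= y0) -> frontier y0 (x n).
Proof.
move=> xy; elim: n => [|n ih].
  rewrite vx.1 => z yz _; split => //= j; exact: le_trans yz.
by have [e ->] := vx.2 n; exact: frontier_step.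
Qed.

Lemma fresh_max (y0 : int) n i : (forall i, x0 i <= y0) -> fresh i y0 n ->
  forall j, (x n).1 j <= (x n).1 i.
Proof. by move=> xy [_ c0 yz]; have [] := frontierP (n := n) xy yz c0. Qed.

(** Choose an edge [y1] beyond [y] and beyond everything reachable before time [n0]. Some walker
    passes it, and by [frontierP] its first crossing goes to the right. *)
Lemma exists_fresh (y0 : int) : (forall i, x0 i <= y0) ->
  (forall y, exists n i, y < (x n).1 i) ->
  forall y n0, exists2 n, (n0 <= n)%N & exists i, fresh i y n.
Proof.
move=> xy unb y n0.
have [y1 yy1 ny1] : exists2 y1 : int, y <= y1 & y0 + n0%:Z <= y1.
  by exists (Num.max y (y0 + n0%:Z)); lia.
have [n [j jn]] := unb y1.
have cn : (x n).2 y1 != 0%N.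
  apply/eqP => c0; have [|+ _] := frontierP (n := n) xy _ c0; first by lia.
  by move=> /(_ j); lia.
have ex : exists n, (x n).2 y1 != 0%N by exists n.
case: (ex_minnP ex) => -[|m] cm min; first by rewrite vx.1 in cm.
have c0 : (x m).2 y1 = 0%N.
  by apply/eqP/negPn/negP => /min; rewrite ltnn.
have [|pm _] := frontierP (n := m) xy _ c0; first by lia.
have [e em] := vx.2 m; move: cm; rewrite em step_cnt c0 add0n eqb0 negbK => /eqP y1e.
have ei : (x m).1 e.1 = y1 /\ e.2.
  by move: y1e; rewrite /edge; have := pm e.1; case: e.2 => /= ? ?; split=> //; lia.
exists m; last first.
  by exists e.1; split; rewrite ?ei.1// em step_posE /target ei.2 ei.1.
by have := pos_le m e.1 xy; rewrite ei.1; lia.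
Qed.

(** Pigeonhole: if each walker had its own last bound and time for fresh crossings, the maxima of
    these would contradict [exists_fresh]. *)
Lemma exists_explorer (y0 : int) : (forall i, x0 i <= y0) ->
  (forall y, exists n i, y < (x n).1 i) -> exists i, explores i.
Proof.
move=> xy unb; apply: contrapT => /forallNP nex.
have {}nex i : exists p : int * nat, forall n, (p.2 <= n)%N -> ~ fresh i p.1 n.
  have /existsNP[y /existsNP[n0 h]] := nex i; exists (y, n0) => n n0n fn.
  by apply: h; exists n.
have [p hp] := choice nex.
pose y : int := \big[Num.max/0]_i (p i).1.
have [n n0 [i [f1 f2 f3]]] := exists_fresh xy unb y (\max_i (p i).2).
apply: (hp i n); first by rewrite (leq_trans _ n0)// leq_bigmax.
by split => //; apply: le_trans f3; exact: le_bigmax.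
Qed.

End Paths.

Lemma lip_ivt (u : nat -> int) (z : int) a b :
  (forall n, u n - 1 <= u n.+1 <= u n + 1) -> (a <= b)%N -> u a <= z <= u b ->
  exists2 n, (a <= n)%N & u n = z.
Proof.
move=> lip /subnK <-; elim: (b - a)%N => [|k ih].
  by rewrite add0n => ?; exists a => //; lia.
move=> zab; have [zk|kz] := leP z (u (k + a)%N); first by apply: ih; lia.
rewrite addSn in zab; exists (k + a).+1%N; first lia.
by have := lip (k + a)%N; lia.
Qed.

Lemma lip_visits (u : nat -> int) : (forall n, u n - 1 <= u n.+1 <= u n + 1) ->
  (forall (y : int) n0, exists2 n, (n0 <= n)%N & u n <= y) ->
  (forall (y : int) n0, exists2 n, (n0 <= n)%N & y <= u n) -> recurrent u.
Proof.
move=> lip dn up z.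
have vis n0 : exists2 n, (n0 <= n)%N & u n = z.
  have [a na ua] := dn z n0; have [b ab ub] := up z a.
  have [|n an un] := lip_ivt (z := z) lip ab; first by rewrite ua ub.
  by exists n => //; exact: leq_trans an.
move=> /finite_seqP[s sE]; have [n ns un] := vis (\max_(m <- s) m).+1.
have : [set` s] n by rewrite -sE.
move=> /= /(leq_bigmax_seq (P := xpredT) (F := id) n) /(_ isT).
by rewrite leqNgt ns.
Qed.

(** * Lyapunov functions *)

Lemma unbounded_counter (u : nat -> nat) :
  (forall n, (u n <= u n.+1)%N) ->
  (forall n, exists2 m, (n <= m)%N & (u m < u m.+1)%N) ->
  forall k, exists n, (k <= u n)%N.
Proof.
move=> mono incr; have mon := homo_leq (leqnn) (fun _ _ _ => @leq_trans _ _ _) mono.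
elim=> [|k [n kn]]; first by exists 0%N.
have [m nm um] := incr n; exists m.+1; apply: leq_ltn_trans um.
by rewrite (leq_trans kn)// mon.
Qed.

Section Walkers.
Context (R : realType) (K : nat) (W : nat -> R).
Hypothesis W1 : forall k, 1 <= W k.
Hypothesis W_homo : {homo W : k l / (k <= l)%N >-> k <= l}.
Implicit Types (x : state K) (e : jump K) (i : 'I_K) (y z : int).

Let W0 k : 0 < W k. Proof. exact: lt_le_trans (W1 k). Qed.

Lemma fair_step_le x i (r a b : R) : pr W x i * a <= pl W x i * b ->
  pr W x i * (r + a) + pl W x i * (r - b) <= r.
Proof.
move=> ab.
have -> : pr W x i * (r + a) + pl W x i * (r - b) =
  (pr W x i + pl W x i) * r + (pr W x i * a - pl W x i * b) by ring.
by rewrite prDpl// mul1r gerDl subr_le0.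
Qed.

Lemma average_le x i (u v r : R) : u <= r -> v <= r ->
  pr W x i * u + pl W x i * v <= r.
Proof.
move=> ur vr; rewrite -[leRHS]mul1r -(prDpl W0 x i) mulrDl.
by rewrite lerD// ler_wpM2l ?pr_ge0 ?pl_ge0.
Qed.

Lemma invW_le k l : (k <= l)%N -> (W l)^-1 <= (W k)^-1.
Proof. by move=> kl; rewrite lef_pV2 ?posrE// W_homo. Qed.

Lemma invW_le1 k : (W k)^-1 <= 1.
Proof. by rewrite invf_le1. Qed.

(** Both sides are the inverse of the sum of the two weights. With frozen weights the resistance
    would thus be a martingale. *)
Lemma pr_invW x i :
  pr W x i * (W (x.2 (x.1 i)))^-1 = pl W x i * (W (x.2 (x.1 i - 1)))^-1.
Proof.
rewrite /pr /pl; set v := W (x.2 (x.1 i - 1)); set u := W (x.2 (x.1 i)).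
have [u0 v0] : 0 < u /\ 0 < v by split; exact: W0.
by field; rewrite !gt_eqF ?addr_gt0.
Qed.

(** * Resistances, and the return of explorers *)

Definition resistance y i x : R :=
  \sum_(k < absz (x.1 i - y)%R) (W (x.2 (y + k%:Z)))^-1.

Lemma resistance_ge0 y i x : 0 <= resistance y i x.
Proof. by apply: sumr_ge0 => k _; rewrite invr_ge0 ltW. Qed.

Lemma resistance_other y i x e : e.1 != i ->
  resistance y i (step x e) <= resistance y i x.
Proof.
move=> ei; rewrite /resistance step_pos [i == _]eq_sym (negPf ei).
by apply: ler_sum => k _; rewrite invW_le// step_cnt leq_addr.
Qed.

(** The edge is added with its weight after reinforcement, while [resistance_left] removes an edge
    with its old weight. This asymmetry makes the drift nonpositive. *)
Lemma resistance_right y i x : y <= x.1 i ->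
  resistance y i (step x (i, true)) = resistance y i x + (W (x.2 (x.1 i)).+1)^-1.
Proof.
move=> yx; rewrite /resistance step_pos eqxx /target /=.
have -> : absz (x.1 i + 1 - y)%R = (absz (x.1 i - y)%R).+1 by lia.
rewrite big_ord_recr /= /edge /=; congr (_ + _).
  apply: eq_bigr => k _; case: eqVneq => [|_]; last by rewrite addn0.
  by have := ltn_ord k; lia.
by rewrite (_ : y + _ = x.1 i) ?eqxx ?addn1//; lia.
Qed.

Lemma resistance_left y i x : y < x.1 i ->
  resistance y i (step x (i, false)) = resistance y i x - (W (x.2 (x.1 i - 1)))^-1.
Proof.
move=> yx; rewrite /resistance step_pos eqxx /target /=.
have -> : absz (x.1 i - y)%R = (absz (x.1 i - 1 - y)%R).+1 by lia.
rewrite [in RHS]big_ord_recr /= /edge /= (_ : y + _ = x.1 i - 1); last by lia.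
rewrite addrK; apply: eq_bigr => k _; case: eqVneq => [|_]; last by rewrite addn0.
by have := ltn_ord k; lia.
Qed.

Context d (T : measurableType d) (P : probability T R).
Context (x0 : 'I_K -> int) (X : 'I_K -> nat -> T -> int) (chosen : nat -> T -> 'I_K).
Hypothesis hX : errw P (fun=> W) x0 X chosen.
Context (i0 : 'I_K).

Local Notation x_ := (traj X).

(** The memory records whether walker i has stayed above y since [n0]; once it has not, [f] is
    killed, which preserves the supermartingale property. *)
Lemma resistance_bounded i y n0 : {ae P, forall w,
  (forall n, (n0 <= n)%N -> y < (x_ w n).1 i) ->
  exists L, forall n, (n0 <= n)%N -> resistance y i (x_ w n) <= L}.
Proof.
pose upd (b : bool) (x x' : state K) := b && (y < x'.1 i).
pose f (b : bool) x := if b then resistance y i x else 0.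
have fle b x : f b x <= resistance y i x.
  by rewrite /f; case: b => //; exact: resistance_ge0.
refine (filterS _ (supermartingale_bounded_walkerwise W0 hX i0 (upd := upd)
  (Inv := fun b x => b -> y < x.1 i) (f := f) (fun x => y < x.1 i) n0 _ _ _)).
- move=> w h ypos; have [|L hL] := h; first by move=> ?; exact: ypos.
  exists L => n /subnKC <-; apply: le_trans (hL (n - n0)%N); rewrite /f.
  rewrite (_ : run _ _ _ _ = true)//; elim: (n - n0)%N => [|k ih].
    by rewrite /= ypos.
  by rewrite runS ih /upd /= ypos// leq_addr.
- by move=> b x _; rewrite /f; case: b => //; exact: resistance_ge0.
- by move=> b x e _ /andP[].
- move=> [] x j /=; last by rewrite /f /= !mulr0 addr0.
  move=> /(_ isT) yx.
  apply: (@le_trans _ _ (pr W x j * resistance y i (step x (j, true)) +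
                         pl W x j * resistance y i (step x (j, false)))).
    by rewrite lerD// ler_wpM2l ?pr_ge0 ?pl_ge0.
  have [->{j}|ji] := eqVneq j i.
    rewrite (resistance_right (ltW yx)) resistance_left//.
    by apply: fair_step_le; rewrite -pr_invW ler_wpM2l ?pr_ge0// invW_le.
  have h b := @resistance_other y i x (j, b) ji.
  exact: average_le.
Qed.
Definition is_fresh i (x x' : state K) : bool :=
  (x'.1 i == x.1 i + 1) && (x.2 (x.1 i) == 0%N).

(* While the resistance t to y stays below L, 2 (L + 1) t - t^2 is a bounded
   supermartingale losing at least (W 1)^-2 on average at each fresh crossing. *)
Lemma explorer_returns_below i y (L n0 : nat) : {ae P, forall w,
  valid x0 (x_ w) -> explores (x_ w) i ->
  (forall n, (n0 <= n)%N -> y < (x_ w n).1 i) ->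
  ~ forall n, (n0 <= n)%N -> resistance y i (x_ w n) <= L%:R}.
Proof.
pose ok x := (y < x.1 i) && (resistance y i x <= L%:R).
pose upd (m : bool * nat) (x x' : state K) :=
  (m.1 && ok x', (m.2 + (m.1 && is_fresh i x x'))%N).
(* One step to the right from resistance at most L leads to at most L+1, where [phi] must still be
   nonnegative. *)
pose phi (t : R) : R := (2 * (L%:R + 1) - t) * t.
pose eps2 : R := (W 1)^-1 ^+ 2.
have eps0 : 0 < eps2 by rewrite exprn_gt0// invr_gt0.
pose f (m : bool * nat) x :=
  (if m.1 then phi (resistance y i x) else 0) + eps2 * m.2%:R.
have phi_ge0 t : 0 <= t -> t <= L%:R + 1 -> 0 <= phi t.
  by move=> t0 tL; rewrite mulr_ge0//; lra.
have phi_le s t : s <= t -> t <= L%:R -> phi s <= phi t.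
  move=> st tL; rewrite -subr_ge0.
  have -> : phi t - phi s = (t - s) * (2 * (L%:R + 1) - (s + t)) by rewrite /phi; ring.
  by rewrite mulr_ge0 ?subr_ge0//; lra.
refine (filterS _ (supermartingale_bounded_walkerwise W0 hX i0 (upd := upd)
  (Inv := fun m x => m.1 -> ok x) (f := f) (fun x => (ok x, 0%N)) n0 _ _ _)).
- move=> w h vx ex ypos rL; have [|L' hL'] := h; first by [].
  pose u n := run upd (ok (x_ w n0), 0%N) (fun n => x_ w (n0 + n)) n.
  have okn n : ok (x_ w (n0 + n)) by rewrite /ok ypos ?rL// leq_addr.
  have u1 n : (u n).1.
    elim: n => [|n ih]; first by have := okn 0%N; rewrite addn0.
    by rewrite /u runS /= -/(u n) ih (okn n.+1).
  have uS n : (u n.+1).2 = ((u n).2 + is_fresh i (x_ w (n0 + n)) (x_ w (n0 + n).+1))%N.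
    by have := u1 n; rewrite /u runS /= addnS => ->.
  have [| |k hk] := @unbounded_counter (fun n => (u n).2) _ _ (Num.bound (L' / eps2)).
  + by move=> n; rewrite uS leq_addr.
  + move=> n; have [m nm [f1 f2 _]] := ex 0 (n0 + n)%N.
    exists (m - n0)%N; first by rewrite leq_subRL// (leq_trans _ nm)// leq_addr.
    rewrite uS subnKC; last by rewrite (leq_trans _ nm)// leq_addr.
    by rewrite /is_fresh f1 f2 !eqxx addn1.
  + have := hL' k; apply/negP; rewrite -ltNge /f.
    apply: (@lt_le_trans _ _ (eps2 * (Num.bound (L' / eps2))%:R)).
      rewrite mulrC -ltr_pdivrMr//.
      have [L0|L0] := leP 0 (L' / eps2); first exact: archi_boundP.
      by rewrite (lt_le_trans L0).
    rewrite -[leLHS]add0r lerD//; last by rewrite ler_pM2l// ler_nat.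
    rewrite u1 phi_ge0// ?resistance_ge0//.
    by apply: ler_wpDr => //; rewrite rL// leq_addr.
- move=> [b N] x /= h; rewrite /f /= addr_ge0//; last by rewrite mulr_ge0// ltW.
  case: b h => [/(_ isT)/andP[_ xL]|//].
  by rewrite phi_ge0 ?resistance_ge0// ler_wpDr.
- by move=> [b N] x e /= h /andP[].
- move=> [[|] N] x j /=; last first.
    by move=> _; rewrite /f /upd /= addn0 add0r -mulrDl prDpl// mul1r.
  move=> /(_ isT)/andP[yx xL].
  set r := resistance y i x in xL *.
  have r0 : 0 <= r by exact: resistance_ge0.
  (* Losing the flag only lowers [f], since [phi] is nonnegative up to L+1; the estimates may ignore
     that case. *)
  have fle x' : resistance y i x' <= L%:R + 1 ->
      f (upd (true, N) x x') x' <=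
      phi (resistance y i x') + eps2 * (is_fresh i x x')%:R + eps2 * N%:R.
    move=> x'L; rewrite /f /upd /= natrD mulrDr [eps2 * N%:R + _]addrC addrA.
    by rewrite !lerD2r; case: (ok x') => //; rewrite phi_ge0// resistance_ge0.
  have [->{j}|ji] := eqVneq j i; last first.
    have main b : f (upd (true, N) x (step x (j, b))) (step x (j, b)) <=
        phi r + eps2 * N%:R.
      have rr := @resistance_other y i x (j, b) ji.
      apply: (le_trans (fle _ _)); first by rewrite (le_trans rr)// ler_wpDr.
      rewrite /is_fresh step_pos [i == _]eq_sym /= (negPf ji).
      rewrite (_ : _ == _ + 1 = false) ?mulr0 ?addr0 ?lerD2r ?phi_le//.
      by apply/negP; lia.
    by apply: average_le; [exact: main|exact: main].
  set c := x.2 (x.1 i).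
  have right_le : f (upd (true, N) x (step x (i, true))) (step x (i, true)) <=
      phi r + eps2 * N%:R + 2 * (L%:R + 1 - r) * (W c.+1)^-1.
    apply: (le_trans (fle _ _)).
      by rewrite (resistance_right (ltW yx)) lerD// invW_le1.
    rewrite (resistance_right (ltW yx)) -/r -/c /phi.
    (* For a fresh crossing [c] is 0, so the quadratic loss of [phi] is exactly [eps2] and pays for
       the counter. *)
    have : eps2 * (is_fresh i x (step x (i, true)))%:R <= (W c.+1)^-1 ^+ 2.
      rewrite /is_fresh step_pos /= eqxx eqxx /= -/c /eps2.
      by case: eqVneq => [->|_]; rewrite ?mulr1// mulr0 exprn_ge0// invr_ge0 ltW.
    move: (eps2 * _%:R) (_^-1) (eps2 * _) => g b a ab; rewrite -subr_ge0.
    by rewrite (_ : _ - _ = b ^+ 2 - a) ?subr_ge0//; ring.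
  have left_le : f (upd (true, N) x (step x (i, false))) (step x (i, false)) <=
      phi r + eps2 * N%:R - 2 * (L%:R + 1 - r) * (W (x.2 (x.1 i - 1)))^-1.
    have lx := resistance_left yx.
    apply: (le_trans (fle _ _)); rewrite lx -/r.
      have : 0 <= (W (x.2 (x.1 i - 1)))^-1 by rewrite invr_ge0 ltW.
      by move: (_^-1) => b; lra.
    rewrite /is_fresh step_pos /= eqxx /target /=.
    rewrite (_ : _ == _ + 1 = false) ?mulr0 ?addr0 /phi; last by apply/negP; lia.
    move: (_^-1) (eps2 * _) => b g; rewrite -subr_ge0.
    by rewrite (_ : _ - _ = b ^+ 2) ?sqr_ge0//; ring.
  apply: (le_trans (lerD (ler_wpM2l (pr_ge0 W0 x i) right_le)
                         (ler_wpM2l (pl_ge0 W0 x i) left_le))).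
  apply: fair_step_le; rewrite mulrCA [leRHS]mulrCA; apply: ler_wpM2l; first lra.
  by rewrite -pr_invW ler_wpM2l ?pr_ge0// invW_le.
Qed.

(** The bound on the resistance is rounded up to a natural number, so that countably many null sets
    suffice. *)
Lemma explorer_returns : {ae P, forall w, forall i, explores (x_ w) i ->
  forall y n0, exists2 n, (n0 <= n)%N & (x_ w n).1 i <= y}.
Proof.
have h1 := ae_forall_count (fun p : 'I_K * int * nat =>
  resistance_bounded p.1.1 p.1.2 p.2).
have h2 := ae_forall_count (fun p : 'I_K * int * (nat * nat) =>
  explorer_returns_below p.1.1 p.1.2 p.2.1 p.2.2).
apply: filterS3 (traj_valid W0 hX i0) h1 h2 => w vw h1 h2 i ex y n0.
apply: contrapT => nex.
have ypos n : (n0 <= n)%N -> y < (x_ w n).1 i.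
  by move=> nn; rewrite ltNge; apply/negP => yn; apply: nex; exists n.
have [L hL] := h1 (i, y, n0) ypos.
apply: (h2 (i, y, (Num.bound `|L|, n0))) => //= n nn; apply: (le_trans (hL n nn)).
by rewrite (le_trans (ler_norm L))// ltW// archi_boundP.
Qed.

(** * Spreading of infinitely many crossings to the next edge *)

Definition away z x : nat := \sum_(j < K) (x.1 j != z).

Lemma away_step z x e :
  (away z (step x e) + (x.1 e.1 != z) = away z x + (target e (x.1 e.1) != z))%N.
Proof.
rewrite /away (bigD1 e.1) //= [in RHS](bigD1 e.1)//= eqxx.
rewrite (eq_bigr (fun j => (x.1 j != z) : nat)); last by move=> j /negPf ->.
lia.
Qed.

(** Two weights u, v that are at least 1 satisfy u + v <= 2uv. *)
Lemma invW_le_pr x i z : x.1 i = z -> (2 * W (x.2 (z - 1)))^-1 <= pr W x i.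
Proof.
move=> xz; rewrite /pr xz; set u := W _; set v := W _.
have [u1 v1] : 1 <= u /\ 1 <= v by split; exact: W1.
rewrite ler_pdivlMr; last lra.
by rewrite ler_pdivrMl; [nra|lra].
Qed.

(* A departure from z through z-1 at a time when z-1 was crossed c times goes
   through z with probability at least 1/(2 W c). As long as z is not crossed, the
   combination c + (number of walkers away from z) increases by 2 at each such
   departure and never otherwise. *)
Lemma edge_spreads_from z (C n0 : nat) :
  (forall B : R, exists n, B <= \sum_(k < n) (W k)^-1) ->
  {ae P, forall w, valid x0 (x_ w) ->
  (forall k, exists n, (k <= (x_ w n).2 (z - 1)%R)%N) ->
  ~ forall n, (n0 <= n)%N -> (x_ w n).2 z = C}.
Proof.
move=> divW.
(* A departure through z-1 raises [U] by 2 and adds two terms to [S]; the factor 4 keeps their sum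
   below the bound of [invW_le_pr]. *)
pose S n : R := \sum_(k < n) (4 * W k)^-1.
have S0 n : 0 <= S n by apply: sumr_ge0 => k _; rewrite invr_ge0 mulr_ge0// ltW.
have S_le m n : (m <= n)%N -> S m <= S n.
  move=> mn; rewrite /S -!(big_mkord xpredT (fun k => (4 * W k)^-1)).
  rewrite (big_cat_nat (leq0n m) mn)//= lerDl; apply: sumr_ge0 => k _.
  by rewrite invr_ge0 mulr_ge0// ltW.
pose U x := (x.2 (z - 1)%R + away z x)%N.
(* Crossing z kills [f]. The summand 1 makes the mean loss at least the probability of that
   crossing, which compensates the growth of [S]. *)
pose f (_ : unit) x := if x.2 z == C then 1 + S (U x) else 0.
refine (filterS _ (supermartingale_bounded_walkerwise W0 hX i0 (upd := fun m _ _ => m)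
  (Inv := fun _ x => (C <= x.2 z)%N) (f := f) (fun=> tt) n0 _ _ _)).
- move=> w h vx unb zC; have [|L hL] := h; first by rewrite zC.
  have [N hN] := divW (4 * L); have [m hm] := unb N.
  have := hL m; rewrite /f zC ?leq_addr// eqxx; apply/negP; rewrite -ltNge.
  apply: (@lt_le_trans _ _ (1 + S N)); last first.
    rewrite lerD2l S_le// /U (leq_trans hm)// (leq_trans _ (leq_addr _ _))//.
    by apply: (cnt_mono vx); rewrite leq_addl.
  have -> : S N = 4^-1 * \sum_(k < N) (W k)^-1.
    by rewrite mulr_sumr; apply: eq_bigr => k _; rewrite invfM.
  by lra.
- by move=> m x _; rewrite /f; case: ifP => // _; rewrite addr_ge0.
- by move=> m x e xC; rewrite step_cnt (leq_trans xC)// leq_addr.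
- move=> m x j; rewrite /f; case: (eqVneq (x.2 z) C) => [zC _|zC Cz]; last first.
    rewrite !step_cnt; case: eqVneq => [|_]; first lia.
    by case: eqVneq => [|_]; [lia|rewrite !mulr0 addr0].
  have FU := S0 (U x).
  have [jz|jz] := eqVneq (x.1 j) z; last first.
    (* A move from z-1 to z adds one crossing of z-1 and brings one walker back to z, so [U] does
       not change. *)
    have main b : (if (step x (j, b)).2 z == C then 1 + S (U (step x (j, b))) else 0)
        <= 1 + S (U x).
      case: ifPn => [|_]; last by rewrite addr_ge0.
      rewrite step_cnt zC => nz; rewrite lerD2l S_le// /U step_cnt.
      have := away_step z x (j, b); rewrite /= jz.
      move: nz; rewrite /edge /target; case: b => /=; case: eqVneq => /=; lia.
    by apply: average_le; exact: main.
  have -> : (step x (j, true)).2 z == C = false.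
    by rewrite step_cnt /edge /= jz eqxx zC addn1 gtn_eqF.
  have -> : (step x (j, false)).2 z == C.
    rewrite step_cnt /edge /= jz zC (_ : z == z - 1 = false) ?addn0//.
    by apply/negP; lia.
  rewrite mulr0 add0r.
  have -> : U (step x (j, false)) = (U x).+2.
    rewrite /U step_cnt; have := away_step z x (j, false).
    rewrite /edge /target /= jz eqxx.
    by case: eqVneq; lia.
  have -> : S (U x).+2 = S (U x) + ((4 * W (U x))^-1 + (4 * W (U x).+1)^-1).
    by rewrite /S !big_ord_recr /= addrA.
  set F := S (U x) in FU *; set dl := _ + _^-1.
  have dle : dl <= pr W x j.
    apply: le_trans (invW_le_pr jz); rewrite /dl !invfM.
    have := invW_le (leqnSn (U x)).
    have : (W (U x))^-1 <= (W (x.2 (z - 1)))^-1 by apply: invW_le; rewrite leq_addr.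
    move: (W _)^-1 (W _)^-1 (W _)^-1 => p q r; lra.
  have dl0 : 0 <= dl by rewrite addr_ge0// invr_ge0 mulr_ge0// ltW.
  rewrite plE//; have := pr_ge0 W0 x j; move: (pr W x j) dle => p dle p0.
  rewrite -subr_ge0.
  have -> : 1 + F - (1 - p) * (1 + (F + dl)) = p * F + p * dl + (p - dl) by ring.
  by rewrite addr_ge0 ?subr_ge0// addr_ge0// mulr_ge0.
Qed.

(** A bounded crossing number attains its maximum and is constant from then on, which
    [edge_spreads_from] excludes for each of countably many values and times. *)
Lemma edge_spreads : (forall B : R, exists n, B <= \sum_(k < n) (W k)^-1) ->
  {ae P, forall w, forall z,
  (forall k, exists n, (k <= (x_ w n).2 (z - 1)%R)%N) ->
  (forall k, exists n, (k <= (x_ w n).2 z)%N)}.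
Proof.
move=> divW.
have h := ae_forall_count (fun p : int * (nat * nat) =>
  edge_spreads_from p.1 p.2.1 p.2.2 divW).
apply: filterS2 (traj_valid W0 hX i0) h => w vw h z unb k.
apply: contrapT => /forallNP nk; have {nk}bk n : ((x_ w n).2 z < k)%N.
  by rewrite ltnNge; apply/negP/nk.
have [n nmax] : exists n, forall m, ((x_ w m).2 z <= (x_ w n).2 z)%N.
  have ex : exists c, `[< exists n, (x_ w n).2 z = c >].
    by exists ((x_ w 0%N).2 z); apply/asboolP; exists 0%N.
  have ub c : `[< exists n, (x_ w n).2 z = c >] -> (c <= k)%N.
    by move=> /asboolP[n <-]; exact: ltnW.
  have [c /asboolP[n nc] cmax] := ex_maxnP ex ub.
  by exists n => m; rewrite nc; apply: cmax; apply/asboolP; exists m.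
apply: (h (z, ((x_ w n).2 z, n))) => //= m nm.
by apply/eqP; rewrite eqn_leq nmax/= (cnt_mono vw).
Qed.

(** * Trapping an explorer on an edge *)

Lemma is_freshP i x e : is_fresh i x (step x e) ->
  e = (i, true) /\ x.2 (x.1 i) = 0%N.
Proof.
rewrite /is_fresh step_pos => /andP[/eqP h /eqP ->]; split => //.
move: h; case: eqVneq => [ie|_]; last by lia.
by rewrite ie {i ie}; case: e => i [] //; rewrite /target /=; lia.
Qed.

Definition below z x : nat := \sum_(j < K) (x.1 j < z)%R.

Lemma below_step z x e :
  (below z (step x e) + (x.1 e.1 < z)%R = below z x + (target e (x.1 e.1) < z)%R)%N.
Proof.
rewrite /below (bigD1 e.1) //= [in RHS](bigD1 e.1)//= eqxx.
rewrite (eq_bigr (fun j => (x.1 j < z)%R : nat)); last by move=> j /negPf ->.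
lia.
Qed.

(** The situation right after a fresh crossing of t-1: both counts next to walker i are known, so
    its next move has explicit probabilities. *)
Definition launched i t x :=
  [/\ x.1 i = t, x.2 t = 0%N, x.2 (t - 1) = 1%N & forall j, j != i -> x.1 j <= t - 1].

(* Walker i stays on the edge t as long as no walker leaves the vertices t and
   t+1 otherwise than through t. The last condition bounds the number of crossings
   of t-1, which can then only be crossed by walkers coming from the left. *)
Definition trapped i t x :=
  [/\ x.2 (t + 1) = 0%N, forall j, x.1 j <= t + 1, t <= x.1 i
    & (x.2 (t - 1)%R + below t x <= K)%N].

Definition escapes t x (x' : state K) : bool :=
  [exists j, (x.1 j == t) && (x'.1 j == t - 1) || (x.1 j == t + 1) && (x'.1 j == t + 2)].

Lemma escapes_step t x e : escapes t x (step x e) =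
  (x.1 e.1 == t) && ~~ e.2 || (x.1 e.1 == t + 1) && e.2.
Proof.
apply/existsP/idP => [[j]|he]; last first.
  by exists e.1; rewrite step_posE; move: he; rewrite /target; case: e.2; lia.
rewrite step_pos; case: (eqVneq j e.1) => [->|_]; last lia.
by rewrite /target; case: e.2; lia.
Qed.

Lemma fresh_launched y0 i x e : frontier y0 x -> y0 <= x.1 i ->
  is_fresh i x (step x e) -> launched i (x.1 i + 1) (step x e).
Proof.
move=> fx yx /is_freshP[-> c0]; have [ple c1] := fx _ yx c0; split.
- by rewrite step_pos eqxx.
- rewrite step_cnt c1 /edge /=; last lia.
  by apply/eqP; rewrite add0n eqb0; lia.
- by rewrite addrK step_cnt c0 /edge eqxx.
- by move=> j /negPf ji; rewrite step_pos /= ji addrK ple.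
Qed.

(** The edge t-1 has been crossed once and at most the K-1 other walkers are below t, which gives
    the bound K in [trapped]. *)
Lemma launched_trapped y0 i t x e : frontier y0 x -> y0 <= t -> launched i t x ->
  is_fresh i x (step x e) -> trapped i t (step x e) /\ (step x e).2 t = 1%N.
Proof.
move=> fx yt [it c0 c1 others] /is_freshP[-> _]; have [ple cz] := fx _ yt c0.
rewrite step_cnt c0 /edge /= it eqxx; split => //; split.
- rewrite step_cnt cz /edge /=; last lia.
  by apply/eqP; rewrite add0n eqb0 it; lia.
- by move=> j; rewrite step_pos /target /=; have := ple j; case: ifP => _; lia.
- by rewrite step_pos eqxx /target /= it; lia.
- have := below_step t x (i, true); rewrite step_cnt /edge /target /= it c1.
  have : (below t x <= K.-1)%N.
    rewrite /below (bigD1 i)//= it ltxx add0n.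
    apply: (@leq_trans (\sum_(j < K | j != i) 1)%N).
      by apply: leq_sum => j _; exact: leq_b1.
    by rewrite sum1_card cardC1 card_ord.
  by have := ltn_ord i; lia.
Qed.

(** Without an escape, t-1 is crossed only from the left, and then one walker fewer is below t. *)
Lemma trapped_step i t x e : trapped i t x -> ~~ escapes t x (step x e) ->
  trapped i t (step x e).
Proof.
move=> [c1 ple ti cb]; rewrite escapes_step => ne; have pe := ple e.1; split.
- rewrite step_cnt c1; apply/eqP; rewrite add0n eqb0.
  by move: ne; rewrite /edge; case: e.2; lia.
- move=> j; rewrite step_pos; have := ple j; case: ifP => // /eqP -> _.
  by move: ne; rewrite /target; case: e.2; lia.
- rewrite step_pos; case: ifP => // /eqP ie; move: ti; rewrite ie.
  by move: ne; rewrite /target; case: e.2; lia.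
- have := below_step t x e; move: cb ne; rewrite step_cnt /edge /target.
  by case: e.2; lia.
Qed.

(** The memory used in [no_explorer]: waiting for a fresh crossing, just after one that led to t, or
    trapped on the edge t. *)
Inductive phase := Idle | Launch of int | Trap of int.

Definition next_phase y0 i (m : phase) x (x' : state K) : phase :=
  match m with
  | Idle => if is_fresh i x x' && (y0 <= x.1 i) then Launch (x.1 i + 1) else Idle
  | Launch t => if is_fresh i x x' then Trap t else Idle
  | Trap t => if escapes t x x' then Idle else Trap t
  end.

Definition phase_inv y0 i (m : phase) x : Prop :=
  match m with
  | Idle => True
  | Launch t => y0 <= t /\ launched i t x
  | Trap t => trapped i t x
  end.

Lemma phase_inv_step y0 i m x e : frontier y0 x -> phase_inv y0 i m x ->
  phase_inv y0 i (next_phase y0 i m x (step x e)) (step x e).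
Proof.
move=> fx; case: m => [_|t [yt lt]|t tt] /=; case: ifPn => //=.
- move=> /andP[fr yx]; split; first lia.
  exact: fresh_launched fx yx fr.
- by move=> /(launched_trapped fx yt lt)[].
- exact: trapped_step.
Qed.

(** If [delta] is at most the product of W l / (W K + W l) over all l, this is a lower bound for the
    tail product over l >= k, that is, for the probability that all further crossings stay on the
    edge. *)
Definition trap_prob (delta : R) (k : nat) : R :=
  delta * \prod_(l < k) (1 + W K / W l).

Lemma trap_probS delta k :
  W k / (W K + W k) * trap_prob delta k.+1 = trap_prob delta k.
Proof.
rewrite /trap_prob big_ord_recr /=; have := W0 k; have := W0 K => u0 v0.
by field; rewrite !gt_eqF ?addr_gt0.
Qed.

(** From 1 + u <= exp u, applied to each factor. *)
Lemma trap_prob_le1 (S : R) k : (forall n, \sum_(l < n) (W l)^-1 <= S) ->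
  trap_prob (expR (- (W K * S))) k <= 1.
Proof.
move=> hS; rewrite /trap_prob expRN mulrC ler_pdivrMr ?expR_gt0// mul1r.
apply: (@le_trans _ _ (expR (W K * \sum_(l < k) (W l)^-1))); last first.
  by rewrite ler_expR ler_wpM2l// ltW.
elim: k => [|k ih]; first by rewrite !big_ord0 mulr0 expR0.
rewrite big_ord_recr/= [X in expR (_ * X)]big_ord_recr/= [W K * (_ + _)]mulrDr.
rewrite expRD ler_pM//.
- by apply: prodr_ge0 => l _; rewrite addr_ge0// divr_ge0// ltW.
- by rewrite addr_ge0// divr_ge0// ltW.
- exact: expR_ge1Dx.
Qed.

Lemma sum_jump_prob_le_sub x (g : jump K -> R) (G : R) e0 : (forall e, g e <= G) ->
  \sum_e jump_prob W x e * g e <= G - jump_prob W x e0 * (G - g e0).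
Proof.
move=> gG; rewrite lerBrDl.
have -> : jump_prob W x e0 * (G - g e0) + \sum_e jump_prob W x e * g e =
    jump_prob W x e0 * G + \sum_(e | e != e0) jump_prob W x e * g e.
  by rewrite (bigD1 e0)//= mulrBr; ring.
rewrite -[leRHS]mul1r -(sum_jump_prob1 W0 i0 x) mulr_suml [leRHS](bigD1 e0)//= lerD2l.
by apply: ler_sum => e _; rewrite ler_wpM2l// jump_prob_ge0.
Qed.

(* The expected number of phases started after the current state is bounded by a
   constant C, since each phase ends in a permanent trap with probability at least
   1/C. *)
Lemma no_explorer i (S : R) : (forall n, \sum_(l < n) (W l)^-1 <= S) ->
  {ae P, forall w, ~ explores (x_ w) i}.
Proof.
move=> hS; have [y0 hy0] : exists y0 : int, forall j, x0 j <= y0.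
  by exists (\big[Num.max/0]_j x0 j) => j; exact: le_bigmax.
pose delta : R := expR (- (W K * S)).
have delta0 : 0 < delta by exact: expR_gt0.
pose h := trap_prob delta.
have h_le1 k : h k <= 1 by exact: trap_prob_le1.
have h_ge0 k : 0 <= h k.
  rewrite mulr_ge0 ?ltW//; apply: prodr_gt0 => l _.
  by rewrite addr_gt0// divr_gt0.
have h1 : delta <= h 1%N.
  by rewrite /h /trap_prob big_ord1 ler_peMr ?(ltW delta0)// lerDl divr_ge0// ltW.
have K0 : (0 < K)%N by have := ltn_ord i; lia.
(* The probability that the launched walker is chosen and makes a second fresh crossing: the edge
   ahead has weight W 0, the one behind W 1. *)
pose eta : R := K%:R^-1 * (W 0 / (W 1 + W 0)).
have eta0 : 0 < eta by rewrite mulr_gt0 ?invr_gt0 ?ltr0n// divr_gt0// addr_gt0.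
pose C : R := (eta * delta)^-1 + 1.
have C1 : 1 <= C by rewrite lerDr invr_ge0 mulr_ge0// ltW.
have C0 : 0 <= C by rewrite (le_trans _ C1).
have etaC : 1 <= eta * (C * delta).
  have ed0 : 0 < eta * delta by rewrite mulr_gt0.
  have -> : eta * (C * delta) = 1 + eta * delta.
    by rewrite [C * _]mulrC mulrA mulrDr mulfV ?gt_eqF// mulr1.
  by rewrite lerDl ltW.
(* A bound for the expected number of later starts. It drops by 1 at a launch, which has just been
   counted; in a trap it is C times a bound for the probability of escape. *)
pose V (m : phase) x : R := match m with
  | Idle => C | Launch _ => C - 1 | Trap t => C * (1 - h (x.2 t)) end.
have V_le m x : V m x <= C.
  case: m => [|t|t] /=; [by []|lra|].
  by rewrite ler_piMr// lerBlDl lerDr h_ge0.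
have V_ge0 m x : 0 <= V m x.
  by case: m => [|t|t] /=; [lra|lra|rewrite mulr_ge0// subr_ge0].
pose started (m : phase) x x' : bool :=
  if m is Idle then is_fresh i x x' && (y0 <= x.1 i) else false.
pose upd (m : phase * nat) x x' :=
  (next_phase y0 i m.1 x x', (m.2 + started m.1 x x')%N).
pose Inv (m : phase * nat) x := frontier y0 x /\ phase_inv y0 i m.1 x.
pose f (m : phase * nat) x := m.2%:R + V m.1 x.
have Inv_step m x e : Inv m x -> Inv (upd m x (step x e)) (step x e).
  by move=> [fx mx]; split; [exact: frontier_step|exact: phase_inv_step].
refine (filterS2 _ _ (traj_valid W0 hX i0) (supermartingale_bounded W0 hX i0 (upd := upd)
  (Inv := Inv) (f := f) (fun=> (Idle, 0%N)) 0 _ Inv_step _)).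
- move=> w vx hw ex; have [|L hL] := hw.
    by split => //; exact: (frontierP vx hy0).
  pose u n := run upd (Idle, 0%N) (x_ w) n.
  have uS n : u n.+1 = upd (u n) (x_ w n) (x_ w n.+1) by exact: runS.
  have uI n : Inv (u n) (x_ w n).
    elim: n => [|n ih]; first by split => //; exact: (frontierP vx hy0).
    by rewrite uS; have [e ->] := vx.2 n; exact: Inv_step.
  have [| |k] := @unbounded_counter (fun n => (u n).2) _ _ (Num.bound L).+1.
  + by move=> n; rewrite uS leq_addr.
  (* If no phase starts any more, the phase is never idle, as the next fresh crossing would start
     one. So it is a trap after at most one step and stays one, which keeps walker i at or below
     t+1. *)
  + move=> n; apply: contrapT => nst.
    have {}nst m : (n <= m)%N -> started (u m).1 (x_ w m) (x_ w m.+1) = false.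
      move=> nm; apply/negP => sm; apply: nst; exists m => //.
      by rewrite uS /= sm addn1.
    have idle_stays m : (n <= m)%N -> (u m).1 = Idle -> forall k, (u (k + m)%N).1 = Idle.
      move=> nm um; elim=> [//|k ih]; rewrite addSn uS /= ih /=.
      have := nst (k + m)%N; rewrite /started ih => -> //.
      by rewrite (leq_trans nm)// leq_addl.
    have not_idle m : (n <= m)%N -> (u m).1 <> Idle.
      move=> nm um; have [k mk [f1 f2 f3]] := ex y0 m.
      have := nst k (leq_trans nm mk); rewrite -(subnK mk) idle_stays//.
      by rewrite /= subnK// /is_fresh f1 f2 f3 !eqxx.
    have [m nm [t ut]] : exists2 m, (n <= m)%N & exists t, (u m).1 = Trap t.
      exists n.+1; rewrite ?leqnSn//.
      have := not_idle n (leqnn n); have := not_idle n.+1 (leqnSn n); rewrite uS /=.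
      by case: (u n).1 => [//|t|t] /=; case: ifP => // _ _ _; exists t.
    have trap_stays k : (u (k + m)%N).1 = Trap t.
      elim: k => [//|k ih]; have := not_idle (k.+1 + m)%N.
      rewrite addSn uS /= ih /=; case: ifP => // _ H; case: (H _) => //.
      by rewrite (leq_trans nm)// -addSn leq_addl.
    have [k mk [_ _ tk]] := ex (t + 2) m.
    have [_] := uI k; rewrite -(subnK mk) trap_stays /= => -[_ /(_ i) ti _ _].
    by move: ti tk; rewrite subnK//; lia.
  + move=> hk; have := hL k; rewrite add0n /f -/(u k); apply/negP; rewrite -ltNge.
    have : L < (Num.bound L).+1%:R.
      have [L0|L0] := leP 0 L; last by rewrite (lt_le_trans L0).
      by rewrite (lt_trans (archi_boundP L0))// ltr_nat.
    move/lt_le_trans; apply.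
    by rewrite -[leLHS]addr0 lerD// ler_nat.
- by move=> m x _; rewrite addr_ge0.
- move=> [m N] x [fx /= mx].
  have f_le e : f (upd (m, N) x (step x e)) (step x e) <=
      N%:R + (started m x (step x e))%:R + V (next_phase y0 i m x (step x e)) (step x e).
    by rewrite /f /= natrD.
  case: m mx f_le => [_|t [yt lt]|t tt] f_le.
  + apply: sum_jump_prob_le => [|j].
      by rewrite addr_ge0.
    have main b : f (upd (Idle, N) x (step x (j, b))) (step x (j, b)) <= N%:R + C.
      apply: (le_trans (f_le _)) => /=; case: ifP => _ /=; last by rewrite addr0.
      lra.
    by apply: average_le; exact: main.
  (* The move (i, true) alone, of probability [eta], lowers the bound C by [C * h 1]; the mean
     decreases by at least 1, down to C-1. *)
  + have le_G e : f (upd (Launch t, N) x (step x e)) (step x e) <= N%:R + C.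
      by rewrite (le_trans (f_le _))//= addr0 lerD2l V_le.
    apply: (le_trans (sum_jump_prob_le_sub x (i, true) le_G)).
    have fr : is_fresh i x (step x (i, true)).
      by case: lt => it c0 _ _; rewrite /is_fresh step_pos eqxx /target /= it c0 !eqxx.
    have [_ tc] := launched_trapped fx yt lt fr.
    have -> : jump_prob W x (i, true) = eta.
      by case: lt => it c0 c1 _; rewrite /jump_prob /pr /= it c0 c1.
    have -> : f (upd (Launch t, N) x (step x (i, true))) (step x (i, true)) =
        N%:R + C * (1 - h ((step x (i, true)).2 t)).
      by rewrite /f /upd [next_phase _ _ _ _ _]/= fr addn0.
    rewrite tc /f.
    have ea : 1 <= eta * (C * h 1%N).
      by rewrite (le_trans etaC)// ler_wpM2l ?ler_wpM2l// ltW.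
    have -> : N%:R + C - (N%:R + C * (1 - h 1%N)) = C * h 1%N by ring.
    by rewrite /V [leRHS]addrA lerB.
  + set k := x.2 t in f_le *.
    have r_k : W k / (W K + W k) * h k.+1 = h k by exact: trap_probS.
    apply: sum_jump_prob_le => [|j]; first by rewrite addr_ge0.
    have fE b : f (upd (Trap t, N) x (step x (j, b))) (step x (j, b)) =
        N%:R + if escapes t x (step x (j, b)) then C else
                 C * (1 - h (k + (t == edge x (j, b)))%N).
      by rewrite /f /= addn0; case: ifP.
    have [c1 ple ti cb] := tt.
    rewrite !fE !escapes_step /edge /= andbT andbF andbF orbF orFb andbT.
    (* Here p is the probability that a mover at t or t+1 crosses t. By [trap_probS] the value of
       [h] is preserved at the least possible p, and a larger p only helps. *)
    have Cr p : W k / (W K + W k) <= p ->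
        p * (N%:R + C * (1 - h k.+1)) + (1 - p) * (N%:R + C) <= N%:R + C * (1 - h k).
      move=> kp; have : C * h k <= p * (C * h k.+1).
        by rewrite [leRHS]mulrCA -r_k ler_wpM2l// ler_wpM2r.
      move: (h k) (h k.+1) => a b; rewrite -subr_ge0 => ab.
      rewrite -subr_ge0 (_ : _ - _ = p * (C * b) - C * a)//; ring.
    have [jt|jt] := eqVneq (x.1 j) t.
      rewrite jt ?eqxx (_ : t == t + 1 = false); last by apply/negP; lia.
      rewrite addn1 plE//.
      have : W k / (W K + W k) <= pr W x j.
        rewrite /pr jt -/k ler_wpM2l ?(ltW (W0 k))// lef_pV2 ?posrE ?addr_gt0// lerD2r.
        by apply: W_homo; apply: leq_trans cb; exact: leq_addr.
      exact: Cr.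
    have [jt1|jt1] := eqVneq (x.1 j) (t + 1).
      rewrite jt1 addrK ?eqxx addn1.
      have : W k / (W K + W k) <= pl W x j.
        rewrite /pl jt1 addrK -/k ler_wpM2l ?(ltW (W0 k))// lef_pV2 ?posrE ?addr_gt0//.
        by rewrite c1 addrC lerD2r W_homo.
      have -> : pr W x j = 1 - pl W x j by rewrite plE//; ring.
      by move=> /Cr kp; rewrite addrC; exact: kp.
    have pj := ple j.
    rewrite (_ : t == x.1 j - 1 = false); last by apply/negP; lia.
    by rewrite addn0; apply: average_le.
Qed.

(** * Races between two walkers and their exchange *)

Fixpoint exit_first (i j : 'I_K) (r : int) (n : nat) x : R :=
  if n is n'.+1 then
    if r < x.1 j then 0 else if r < x.1 i then 1 else
    \sum_e jump_prob W x e * exit_first i j r n' (step x e)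
  else 0.

Lemma sum_jump_prob_bound x (g : jump K -> R) (G : R) : (forall e, g e <= G) ->
  \sum_e jump_prob W x e * g e <= G.
Proof.
move=> gG; rewrite -[leRHS]mul1r -(sum_jump_prob1 W0 i0 x) mulr_suml.
by apply: ler_sum => e _; rewrite ler_wpM2l// jump_prob_ge0.
Qed.

Lemma exit_first_ge0 i j r n x : 0 <= exit_first i j r n x.
Proof.
elim: n x => [//|n ih] x /=; case: ifP => // _; case: ifP => // _.
by apply: sumr_ge0 => e _; rewrite mulr_ge0// jump_prob_ge0.
Qed.

Lemma exit_first_le1 i j r n x : exit_first i j r n x <= 1.
Proof.
elim: n x => [//|n ih] x /=; case: ifP => // _; case: ifP => // _.
exact: sum_jump_prob_bound.
Qed.

Lemma exit_first_mono i j r x : nondecreasing_seq (fun n => exit_first i j r n x).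
Proof.
apply/nondecreasing_seqP => n; elim: n x => [|n ih] x.
  exact: exit_first_ge0.
rewrite [leLHS]/= [leRHS]/=; case: ifP => // _; case: ifP => // _.
by apply: ler_sum => e _; rewrite ler_wpM2l ?jump_prob_ge0//; exact: ih.
Qed.

(** The two walkers cannot both win; the sum may be less than 1 because the race may be
    undecided. *)
Lemma exit_first_sum i j r n x : exit_first i j r n x + exit_first j i r n x <= 1.
Proof.
elim: n x => [|n ih] x /=; first by rewrite addr0.
case: ifP => [_|_]; first by case: ifP; rewrite add0r.
case: ifP => [_|_]; first by rewrite addr0.
rewrite -big_split /=; under eq_bigr do rewrite -mulrDr.
exact: sum_jump_prob_bound.
Qed.

Definition swap i j x : state K := (fun l => x.1 (tperm i j l), x.2).

(** The weights do not see the labels of the walkers, so relabelling the moves by the transposition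
    permutes the branches with their probabilities. *)
Lemma exit_first_swap i j r n x :
  exit_first i j r n (swap i j x) = exit_first j i r n x.
Proof.
elim: n x => [//|n ih] x /=; rewrite tpermL tpermR.
case: ifP => // _; case: ifP => // _.
have inv : injective (fun e : jump K => (tperm i j e.1, e.2)).
  by move=> [l b] [l' b'] [/perm_inj -> ->].
rewrite [RHS](reindex_inj inv) /=; apply: eq_bigr => -[l b] _ /=.
congr (_ * _); rewrite -ih; congr exit_first.
apply/pair_equal_spec; split=> //; apply/funext => l' /=.
by rewrite (inj_eq perm_inj).
Qed.

(** At a meeting the exchange fixes the state, so both walkers win with equal probability, and these
    add up to at most 1. *)
Lemma exit_first_meet i j r n x : x.1 i = x.1 j -> exit_first i j r n x <= 2^-1.
Proof.
move=> xij; have sx : swap i j x = x.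
  rewrite [RHS]surjective_pairing; apply/pair_equal_spec; split=> //; apply/funext => l /=.
  by case: tpermP => // ->.
have := exit_first_sum i j r n x; rewrite -[exit_first j i _ _ _]exit_first_swap sx.
by lra.
Qed.

Definition exit_prob i j r x : R := limn (fun n => exit_first i j r n x).

Lemma exit_prob_cvg i j r x :
  (fun n => exit_first i j r n x) @ \oo --> exit_prob i j r x.
Proof.
apply: nondecreasing_is_cvgn; first exact: exit_first_mono.
by exists 1 => _ [n _ <-]; exact: exit_first_le1.
Qed.

Lemma exit_prob_ge0 i j r x : 0 <= exit_prob i j r x.
Proof.
apply: limr_ge; first exact: exit_prob_cvg.
by apply: nearW => n; exact: exit_first_ge0.
Qed.

Lemma exit_prob_meet i j r x : x.1 i = x.1 j -> exit_prob i j r x <= 2^-1.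
Proof.
move=> xij; apply: limr_le; first exact: exit_prob_cvg.
by apply: nearW => n; exact: exit_first_meet.
Qed.

Lemma exit_prob1 i j r x : x.1 j <= r -> r < x.1 i -> exit_prob i j r x = 1.
Proof.
move=> jr ri; apply/cvg_lim => //; apply/cvgrPdist_le => e e0.
near=> n; have n0 : (0 < n)%N by near: n; exists 1%N.
by rewrite -(prednK n0) /= ltNge jr /= ri subrr normr0 ltW.
Unshelve. all: by end_near. Qed.

Lemma exit_prob_harmonic i j r x : x.1 i <= r -> x.1 j <= r ->
  \sum_e jump_prob W x e * exit_prob i j r (step x e) <= exit_prob i j r x.
Proof.
move=> ir jr.
have cv : (fun n => \sum_e jump_prob W x e * exit_first i j r n (step x e)) @ \oo -->
    \sum_e jump_prob W x e * exit_prob i j r (step x e).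
  apply: cvg_big => [|e _]; first exact: add_continuous.
  by apply: cvgM; [exact: cvg_cst|exact: exit_prob_cvg].
rewrite -(cvg_lim _ cv)//; apply: limr_le; first by apply/cvg_ex; eexists; exact: cv.
apply: nearW => n; apply: le_trans (nondecreasing_cvgn_le _ _ n.+1).
- by rewrite /= !ltNge ir jr.
- exact: exit_first_mono.
- exact: exit_prob_cvg.
Qed.

(* Each time i meets j below r, the walker i is the first of the two to exceed r
   with probability at most 1/2, since exchanging the two walkers does not change
   the state. As long as j has not exceeded r, the number N of such races won by i
   yields the supermartingale N+1, or (N+2) P(i wins) during a race. *)
Lemma no_confined_meeting i j (r : int) (n0 : nat) : {ae P, forall w,
  (forall n, (n0 <= n)%N -> (x_ w n).1 j <= r) ->
  (forall n, exists2 m, (n <= m)%N & (x_ w m).1 i = (x_ w m).1 j) ->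
  ~ forall n, exists2 m, (n <= m)%N & r < (x_ w m).1 i}.
Proof.
(* [None] records that j has exceeded r. Otherwise the flag tells whether a race is running, and the
   number counts the races won by i. *)
pose upd (m : option (bool * nat)) (x x' : state K) : option (bool * nat) :=
  if r < x'.1 j then None else
  match m with
  | None => None
  | Some (false, N) => Some (x'.1 i == x'.1 j, N)
  | Some (true, N) => if r < x'.1 i then Some (false, N.+1) else Some (true, N)
  end.
pose Inv (m : option (bool * nat)) x : Prop :=
  if m is Some (true, _) then x.1 i <= r /\ x.1 j <= r else True.
pose f (m : option (bool * nat)) x : R := match m with
  | None => 0
  | Some (false, N) => N.+1%:R
  | Some (true, N) => N.+2%:R * exit_prob i j r x
  end.
refine (filterS _ (supermartingale_bounded W0 hX i0 (upd := upd) (Inv := Inv) (f := f)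
  (fun=> Some (false, 0%N)) n0 _ _ _)).
- move=> w hw jr meet exit; have [|L hL] := hw; first by [].
  pose x n := x_ w (n0 + n).
  pose u n := run upd (Some (false, 0%N)) x n.
  pose c n := if u n is Some (_, N) then N else 0%N.
  pose b n := if u n is Some (b, _) then b else false.
  have uE n : u n = Some (b n, c n).
    rewrite /b /c; suff : u n <> None by case: (u n) => [[]|].
    elim: n => [//|n ih]; rewrite /u runS -/(u n) /upd -/(x n.+1).
    rewrite ltNge jr ?leq_addr//=; case: (u n) ih => // -[[] N] _ //.
    by case: ifP.
  have uS n : u n.+1 = if b n then if r < (x n.+1).1 i then Some (false, (c n).+1)
      else Some (true, c n) else Some ((x n.+1).1 i == (x n.+1).1 j, c n).
    by rewrite {1}/u runS -/(u n) /upd uE ltNge jr ?leq_addr.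
  have cS n : c n.+1 = (c n + (b n && (r < (x n.+1).1 i)%R))%N.
    rewrite {1}/c uS; case: (b n) => /=; last by rewrite addn0.
    by case: ifP; rewrite ?addn1 ?addn0.
  have bS n : b n.+1 = if b n then ~~ (r < (x n.+1).1 i) else (x n.+1).1 i == (x n.+1).1 j.
    by rewrite {1}/b uS; case: (b n) => //; case: ifP.
  have shift (A : state K -> Prop) : (forall n, exists2 m, (n <= m)%N & A (x_ w m)) ->
      forall n, exists2 m, (n <= m)%N & A (x m.+1).
    move=> hA n; have [m nm Am] := hA (n0 + n).+1%N.
    exists (m - n0).-1; first lia.
    by rewrite /x (_ : (n0 + _)%N = m)//; lia.
  (* Outside a race the next meeting starts one, and a race ends because i exceeds r again while j
     never does. *)
  have inc n : exists2 m, (n <= m)%N & (c m < c m.+1)%N.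
    apply: contrapT => ninc.
    have {}ninc m : (n <= m)%N -> b m -> r < (x m.+1).1 i = false.
      move=> nm bm; apply/negP => rm; apply: ninc; exists m => //.
      by rewrite cS bm rm addn1.
    have b_stays m : (n <= m)%N -> b m -> forall k, b (k + m)%N.
      move=> nm bm; elim=> [//|k ih]; rewrite addSn bS ih ninc//.
      by rewrite (leq_trans nm)// leq_addl.
    have nb m : (n <= m)%N -> ~~ b m.
      move=> nm; apply/negP => bm; have [k mk rk] := shift (fun x => r < x.1 i) exit m.
      move: rk; rewrite ninc//; first exact: leq_trans mk.
      by rewrite -(subnK mk) b_stays.
    have [k nk xk] := shift (fun x => x.1 i = x.1 j) meet n.
    have := nb k.+1; rewrite bS (negPf (nb _ nk)) xk eqxx => /(_ _)/negP.
    by apply => //; exact: leqW.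
  have c_le n : (c n <= c n.+1)%N by rewrite cS leq_addr.
  have [k hk] := unbounded_counter c_le inc (Num.bound L).
  have [m km cm] := inc k.
  have bm : b m && (r < (x m.+1).1 i).
    by move: cm; rewrite cS; case: (b m && _) => //; rewrite addn0 ltnn.
  have := hL m.+1; rewrite -/(x m.+1) -/(u m.+1) uE bS; case/andP: bm => -> -> /=.
  apply/negP; rewrite -ltNge /f.
  have cmono : (c k <= c m)%N.
    exact: (homo_leq (leqnn) (fun _ _ _ => @leq_trans _ _ _) c_le).
  have : L < (c m.+1).+1%:R.
    have [L0|L0] := leP 0 L; last by rewrite (lt_le_trans L0).
    by rewrite (lt_le_trans (archi_boundP L0))// ler_nat; lia.
  by [].
- by move=> [[[] N]|] x _ //=; rewrite mulr_ge0// exit_prob_ge0.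
- move=> m x e; rewrite /upd; case: ifP => // /negbT; rewrite -leNgt => jr.
  case: m => [[[] N]|] //; first by case: ifP => // /negbT; rewrite -leNgt.
  by rewrite /Inv; case: eqP => // ->.
- move=> [[[] N]|] x.
  + move=> [ir jr].
    (* When i wins, [exit_prob] is 1, and N+2 is exactly the value after N+1 wins outside a race. *)
    apply: (@le_trans _ _ (N.+2%:R * \sum_e jump_prob W x e * exit_prob i j r (step x e))).
      rewrite mulr_sumr; apply: ler_sum => e _; rewrite mulrCA.
      rewrite ler_wpM2l ?jump_prob_ge0// /upd; case: ifP => [_|/negbT].
        by rewrite mulr_ge0// exit_prob_ge0.
      by rewrite -leNgt => jr'; case: ifP => // ri; rewrite /f exit_prob1// mulr1.
    by rewrite ler_wpM2l// exit_prob_harmonic.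
  + move=> _; apply: sum_jump_prob_bound => e; rewrite /upd; case: ifP => // _.
    rewrite /f; case: eqP => // /exit_prob_meet hm.
    (* A starting race is worth at most (N+2)/2, which is at most N+1. *)
    apply: (@le_trans _ _ (N.+2%:R * 2^-1)); first by rewrite ler_wpM2l.
    by rewrite ler_pdivrMr// -natrM ler_nat; lia.
  + move=> _; rewrite big1// => e _; rewrite /upd.
    by case: ifP; rewrite mulr0.
Qed.

End Walkers.

(** * Recurrence and finite range *)

Section Reflection.
Context (R : realType) (K : nat) (W : nat -> R).
Context d (T : measurableType d) (P : probability T R).

(** Reflection sends the endpoints z and z+1 to -z and -z-1, hence the edge z to the edge -z-1. *)
Lemma crosses_opp z p p' : crosses z (- p) (- p') = crosses (- z - 1) p p'.
Proof. by rewrite /crosses; lia. Qed.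

Lemma crossings_opp (h : 'I_K -> nat -> int) n z :
  crossings (fun i m => - h i m) n z = crossings h n (- z - 1).
Proof. by apply: eq_bigr => m _; apply: eq_bigr => i _; rewrite crosses_opp. Qed.

Lemma errw_opp (x0 : 'I_K -> int) (X : 'I_K -> nat -> T -> int) chosen :
  errw P (fun=> W) x0 X chosen ->
  errw P (fun=> W) (fun i => - x0 i) (fun i n w => - X i n w) chosen.
Proof.
move=> hX; pose X' i n w : int := - X i n w.
have histE n h c : history X' chosen n h c = history X chosen n (fun i m => - h i m) c.
  apply/seteqP; split => w [hw cw]; split => // i m mn.
    by rewrite -hw// /X' opprK.
  by rewrite /X' hw// opprK.
have wE (h : 'I_K -> nat -> int) n z :
    weight (fun=> W) h n z = weight (fun=> W) (fun i m => - h i m) n (- z - 1).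
  by rewrite /weight (crossings_opp h); congr (W (crossings _ _ _)); lia.
have XE i n z : [set w | X' i n w = z] = [set w | X i n w = - z].
  by apply/seteqP; split => w; rewrite /X' /=; lia.
split.
- by move=> i n z; rewrite XE; exact: (errw_measurable hX).
- exact: (errw_measurable_chosen hX).
- by apply: filterS (errw_init hX) => w wx i; rewrite wx.
- by apply: filterS (errw_unchosen hX) => w wx n j jc; rewrite wx.
- by move=> n h c i; rewrite histE (errw_chosen hX).
- move=> n h c i z; rewrite histE XE (_ : - (z + 1) = - z - 1); last lia.
  have := errw_left hX n (fun i m => - h i m) c i; rewrite /= -/z => ->.
  rewrite (wE h n z) (wE h n (z - 1)) (_ : - (z - 1) - 1 = - z); last lia.
  by rewrite [X in _ / X]addrC.
- move=> n h c i z; rewrite histE XE (_ : - (z - 1) = - z + 1); last lia.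
  have := errw_right hX n (fun i m => - h i m) c i; rewrite /= -/z => ->.
  rewrite (wE h n z) (wE h n (z - 1)) (_ : - (z - 1) - 1 = - z); last lia.
  by rewrite [X in _ / X]addrC.
Qed.

End Reflection.

Lemma bounded_valid_cnt K (x0 : 'I_K -> int) (x : nat -> state K) (B : int) :
  valid x0 x -> (forall n i, (x n).1 i <= B) -> forall n z, B < z -> (x n).2 z = 0%N.
Proof.
move=> vx xB n z Bz; elim: n => [|n ih]; first by rewrite vx.1.
have [e xe] := vx.2 n; rewrite xe step_cnt ih; apply/eqP; rewrite add0n eqb0.
by have := xB n e.1; rewrite /edge; case: e.2; lia.
Qed.

Lemma bounded_valid_edge K (x0 : 'I_K -> int) (x : nat -> state K) (B : nat) :
  valid x0 x -> (forall n i, - B%:Z <= (x n).1 i <= B%:Z) ->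
  exists z, forall k, exists n, (k <= (x n).2 z)%N.
Proof.
move=> vx xB; apply: contrapT => /forallNP nz.
have {}nz z : exists k, forall n, ((x n).2 z < k)%N.
  have /existsNP[k /forallNP nk] := nz z; exists k => n; rewrite ltnNge.
  by apply/negP; exact: nk.
have [b hb] := choice nz.
(* The edges from -B-1 to B are all that a move from within [-B, B] can cross; each move adds one to
   the total of their counts. *)
pose N := (B + B).+2; pose z (k : 'I_N) : int := k%:Z - B%:Z - 1.
have total n : (n <= \sum_k (x n).2 (z k))%N.
  elim: n => [//|n ih]; have [e xe] := vx.2 n; rewrite xe.
  under eq_bigr do rewrite step_cnt.
  rewrite big_split /= -addn1 leq_add//.
  have ek : (absz (edge (x n) e + B%:Z + 1)%R < N)%N.
    by have := xB n e.1; rewrite /edge /N; case: e.2; lia.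
  rewrite (bigD1 (Ordinal ek))//= (_ : z _ == _) //.
  by have := xB n e.1; rewrite /z /edge /=; case: e.2; lia.
have := total (\sum_k b (z k))%N; apply/negP; rewrite -ltnNge.
have K0 : (0 < N)%N by [].
rewrite (bigD1 (Ordinal K0))//= [ltnRHS](bigD1 (Ordinal K0))//= -addSn leq_add//.
by apply: leq_sum => k _; exact: ltnW.
Qed.

(** Only one walker moves at a time, so two walkers cannot change their order without meeting. *)
Lemma gap_lip K (x0 : 'I_K -> int) (x : nat -> state K) i j : valid x0 x ->
  forall n, (x n).1 i - (x n).1 j - 1 <= (x n.+1).1 i - (x n.+1).1 j
    <= (x n).1 i - (x n).1 j + 1.
Proof.
move=> vx n; have [e ->] := vx.2 n; rewrite !step_pos /target.
case: (eqVneq i e.1) => [->|ie]; case: (eqVneq j e.1) => [->|je]; case: e.2; lia.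
Qed.

(** * The two regimes *)

Section Dichotomy.
Context (R : realType) (K : nat) (W : nat -> R).
Hypothesis W1 : forall k, 1 <= W k.
Hypothesis W_homo : {homo W : k l / (k <= l)%N >-> k <= l}.
Context d (T : measurableType d) (P : probability T R).
Context (i0 : 'I_K).

(** Stated for arbitrary paths [u], so that on reflected positions it describes a walker that is
    infinitely often the leftmost one. *)
Definition high_explorer (u : 'I_K -> nat -> int) i :=
  (forall y n0, exists2 n, (n0 <= n)%N & u i n <= y) /\
  (forall y n0, exists2 n, (n0 <= n)%N & y <= u i n /\ forall j, u j n <= u i n).

Lemma exists_high_explorer
    (x0 : 'I_K -> int) (X : 'I_K -> nat -> T -> int) (chosen : nat -> T -> 'I_K) :
  errw P (fun=> W) x0 X chosen ->
  {ae P, forall w, (forall y, exists n i, y < X i n w) ->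
    exists i, high_explorer (fun i n => X i n w) i}.
Proof.
move=> hX; have [y0 hy0] : exists y0 : int, forall j, x0 j <= y0.
  by exists (\big[Num.max/0]_j x0 j) => j; exact: le_bigmax.
have W0 k : 0 < W k by exact: lt_le_trans (W1 k).
apply: filterS2 (traj_valid W0 hX i0) (explorer_returns W1 W_homo hX i0) => w vx ret unb.
have [i ex] := exists_explorer vx hy0 unb.
exists i; split => [y n0|y n0]; first exact: (ret i ex y n0).
have [n nn [f1 f2 f3]] := ex (Num.max y0 y) n0; exists n => //; split.
  by apply: le_trans f3; rewrite le_max lexx orbT.
have fr : fresh (traj X w) i y0 n by split=> //; apply: le_trans f3; rewrite le_max lexx.
exact: (fresh_max vx hy0 fr).
Qed.

(** If j stayed at or below r, walker k would be to its left infinitely often and, after each such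
    time, beyond r again. By [gap_lip] they meet in between, which [no_confined_meeting]
    excludes. *)
Lemma low_explorer_frees
    (x0 : 'I_K -> int) (X : 'I_K -> nat -> T -> int) (chosen : nat -> T -> 'I_K) :
  errw P (fun=> W) x0 X chosen ->
  {ae P, forall w, forall k, high_explorer (fun i n => - X i n w) k ->
    forall j r n0, exists2 n, (n0 <= n)%N & r <= X j n w}.
Proof.
move=> hX; have W0 k : 0 < W k by exact: lt_le_trans (W1 k).
have hD := ae_forall_count (fun p : ('I_K * 'I_K) * (int * nat) =>
  no_confined_meeting W1 hX i0 p.1.1 p.1.2 p.2.1 p.2.2).
apply: filterS2 (traj_valid W0 hX i0) hD => w vx hD k [dn up] j r n0.
apply: contrapT => nj.
have jr n : (n0 <= n)%N -> X j n w <= r.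
  by move=> nn; rewrite leNgt; apply/negP => /ltW rj; apply: nj; exists n.
have kr n : exists2 m, (n <= m)%N & r < X k m w.
  by have [m nm km] := dn (- r - 1) n; exists m => //; lia.
apply: (hD ((k, j), (r, n0))) => //= n.
have [a na [_ /(_ j) aj]] := up 0 (maxn n n0).
have [b ab bk] := kr a.
have [|m am mk] := lip_ivt (z := 0) (gap_lip k j vx) ab.
  by have := jr b; rewrite /=; lia.
by exists m; [lia|rewrite /= in mk *; lia].
Qed.

Lemma all_recurrent
    (x0 : 'I_K -> int) (X : 'I_K -> nat -> T -> int) (chosen : nat -> T -> 'I_K) :
  errw P (fun=> W) x0 X chosen ->
  (forall B : R, exists n, B <= \sum_(k < n) (W k)^-1) ->
  {ae P, forall w, forall i, recurrent (fun n => X i n w)}.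
Proof.
move=> hX divW; have hX' := errw_opp hX.
have W0 k : 0 < W k by exact: lt_le_trans (W1 k).
near=> w => j.
have vx : valid x0 (traj X w) by near: w; exact: (traj_valid W0 hX i0).
have high : (forall y, exists n i, y < X i n w) ->
    exists i, high_explorer (fun i n => X i n w) i.
  by near: w; exact: (exists_high_explorer hX).
have low : (forall y, exists n i, y < - X i n w) ->
    exists i, high_explorer (fun i n => - X i n w) i.
  by near: w; exact: (exists_high_explorer hX').
have edge_r z :
    (forall k, exists n, (k <= crossings (fun i m => X i m w) n (z - 1)%R)%N) ->
    forall k, exists n, (k <= crossings (fun i m => X i m w) n z)%N.
  by move: z; near: w; exact: (edge_spreads W1 W_homo hX i0 divW).
have edge_l z :
    (forall k, exists n, (k <= crossings (fun i m => - X i m w) n (z - 1)%R)%N) ->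
    forall k, exists n, (k <= crossings (fun i m => - X i m w) n z)%N.
  by move: z; near: w; exact: (edge_spreads W1 W_homo hX' i0 divW).
have frees : forall k, high_explorer (fun i n => - X i n w) k ->
    forall j r n0, exists2 n, (n0 <= n)%N & r <= X j n w.
  by near: w; exact: (low_explorer_frees hX).
have frees' : forall k, high_explorer (fun i n => - - X i n w) k ->
    forall j r n0, exists2 n, (n0 <= n)%N & r <= - X j n w.
  by near: w; exact: (low_explorer_frees hX').
have oppX : (fun i n => - - X i n w) = (fun i n => X i n w).
  by apply/funext => i; apply/funext => n; rewrite opprK.
rewrite {}oppX in frees'.
have edge_l' z : (forall k, exists n, (k <= (traj X w n).2 z)%N) ->
    forall k, exists n, (k <= (traj X w n).2 (z - 1)%R)%N.
  move=> hz k; have [|n hn] := edge_l (- z) _ k.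
    move=> l; have [n hn] := hz l; exists n.
    by rewrite crossings_opp (_ : - (- z - 1) - 1 = z)//; lia.
  by exists n; move: hn; rewrite crossings_opp opprK.
have all_edges z z' : (forall k, exists n, (k <= (traj X w n).2 z)%N) ->
    forall k, exists n, (k <= (traj X w n).2 z')%N.
  move=> hz; have up m : forall k, exists n, (k <= (traj X w n).2 (z + m%:Z)%R)%N.
    elim: m => [|m ih]; first by rewrite addr0.
    by apply: edge_r; rewrite (_ : _ - 1 = z + m%:Z)//; lia.
  have down m : forall k, exists n, (k <= (traj X w n).2 (z - m%:Z)%R)%N.
    elim: m => [|m ih]; first by rewrite subr0.
    by rewrite (_ : _ - _ = z - m%:Z - 1); [exact: edge_l'|lia].
  have [zz|zz] := leP z z'.
    by have := up (absz (z' - z)%R); rewrite (_ : z + _ = z')//; lia.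
  by have := down (absz (z' - z)%R); rewrite (_ : z - _ = z')//; lia.
have [i hi] : exists i, high_explorer (fun i n => X i n w) i \/
    high_explorer (fun i n => - X i n w) i.
  have [/high[i hi]|/existsNP[y1 /forallNP ny1]] :=
    pselect (forall y, exists n i, y < X i n w); first by exists i; left.
  have [/low[i hi]|/existsNP[y2 /forallNP ny2]] :=
    pselect (forall y, exists n i, y < - X i n w); first by exists i; right.
  pose B := (`|y1| + `|y2|)%N.
  have XB n i : - B%:Z <= (traj X w n).1 i <= B%:Z.
    have X1 : X i n w <= y1.
      by rewrite leNgt; apply/negP => h; apply: (ny1 n); exists i.
    have X2 : - X i n w <= y2.
      by rewrite leNgt; apply/negP => h; apply: (ny2 n); exists i.
    by rewrite /traj /B /=; lia.
  (* With a bounded range some edge is crossed infinitely often, hence all are, even B+1, which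
     nobody can reach. *)
  have [z hz] := bounded_valid_edge vx XB.
  have [n] := all_edges z (B%:Z + 1) hz 1%N.
  rewrite (bounded_valid_cnt (B := B%:Z) vx)// ?ltrDl// => m i0'.
  by case/andP: (XB m i0').
(* An explorer on one side returns beyond every bound on the other side, so explorers exist on both
   sides. *)
have [k hk] : exists k, high_explorer (fun i n => - X i n w) k.
  case: hi => [[dn _]|hi]; last by exists i.
  apply: low => y; have [n _ hn] := dn (- y - 1) 0%N; exists n, i; lia.
have {i hi}[i hi] : exists i, high_explorer (fun i n => X i n w) i.
  case: hk => [dn _]; apply: high => y.
  by have [n _ hn] := dn (- y - 1) 0%N; exists n, k; lia.
apply: lip_visits.
- by move=> n; have := pos_lip vx n j.
- move=> y n0; have [n nn hn] := frees' i hi j (- y) n0; exists n => //; lia.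
- exact: frees hk j.
Unshelve. all: by end_near. Qed.

Lemma all_finite_range
    (x0 : 'I_K -> int) (X : 'I_K -> nat -> T -> int) (chosen : nat -> T -> 'I_K)
    (S : R) :
  errw P (fun=> W) x0 X chosen ->
  (forall n, \sum_(k < n) (W k)^-1 <= S) ->
  {ae P, forall w, forall i, finite_range (fun n => X i n w)}.
Proof.
have W0 k : 0 < W k by exact: lt_le_trans (W1 k).
have bounded (x1 : 'I_K -> int) (Y : 'I_K -> nat -> T -> int)
    (chosen1 : nat -> T -> 'I_K) :
    errw P (fun=> W) x1 Y chosen1 ->
    (forall n, \sum_(k < n) (W k)^-1 <= S) ->
    {ae P, forall w, exists y, forall n i, Y i n w <= y}.
  move=> hY hS; have [y0 hy0] : exists y0 : int, forall j, x1 j <= y0.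
    by exists (\big[Num.max/0]_j x1 j) => j; exact: le_bigmax.
  have nex := ae_forall_count (fun i : 'I_K => no_explorer W1 W_homo hY i0 i hS).
  apply: filterS2 (traj_valid W0 hY i0) nex => w vx nex.
  apply: contrapT => nb; have [y|i /(nex i)//] := exists_explorer vx hy0.
  apply: contrapT => /forallNP ny; apply: nb; exists y => n i.
  by rewrite leNgt; apply/negP => h; apply: (ny n); exists i.
move=> hX hS.
apply: filterS2 (bounded _ _ _ hX hS) (bounded _ _ _ (errw_opp hX) hS).
move=> w [y1 hy1] [y2 hy2] i; pose N := (`|y1| + `|y2|)%N.
apply: (@sub_finite_set _ _ ((fun k : nat => k%:Z - N%:Z) @` `I_(N + N).+1)).
  move=> _ [n _ <-] /=; exists (absz (X i n w + N%:Z)%R);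
    by have := hy1 n i; have := hy2 n i; rewrite /N; lia.
exact/finite_image/finite_II.
Qed.

End Dichotomy.

Theorem theorem18 (R : realType) (K : nat) (hK : (1 <= K)%N)
    (a : nat -> R) (ha : forall k, (1 <= k)%N -> 0 <= a k)
    (d : measure_display) (T : measurableType d) (P : probability T R)
    (x0 : 'I_K -> int) (X : 'I_K -> nat -> T -> int)
    (chosen : nat -> T -> 'I_K)
    (hX : errw P (seq_reinf a) x0 X chosen) :
  (phi a = +oo%E ->
     {ae P, forall w, forall i, recurrent (fun n => X i n w)}) /\
  ((phi a < +oo)%E ->
     {ae P, forall w, forall i, finite_range (fun n => X i n w)}).
Proof.
(* The reinforcement is the same at all edges, so the edge 0 represents them all. *)
pose W := seq_reinf a 0.
have W_homo : {homo W : k l / (k <= l)%N >-> k <= l} := (seq_reinfP ha).2 0.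
have W1 k : 1 <= W k.
  have -> : 1 = W 0 by rewrite /W /seq_reinf big_geq ?addr0.
  exact: W_homo.
have iW0 k : 0 <= (W k)^-1 by rewrite invr_ge0 (le_trans _ (W1 k)).
have sumW n : \sum_(1 <= k < n.+1) ((W k)^-1)%:E = (\sum_(k < n) (W k.+1)^-1)%:E.
  by rewrite big_add1 big_mkord sumEFin.
split=> phia.
- apply: (all_recurrent W1 W_homo (Ordinal hK) hX) => B.
  apply: contrapT => /forallNP nB; have : (phi a <= B%:E)%E.
    apply: lime_le; first by apply: is_cvg_nneseries => k _ _; rewrite lee_fin; exact: iW0.
    apply: nearW => -[|n].
      rewrite big_geq// lee_fin ltW// ltNge.
      by apply/negP => B0; apply: (nB 0%N); rewrite big_ord0.
    rewrite sumW lee_fin (@le_trans _ _ (\sum_(k < n.+1) (W k)^-1))//.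
      by rewrite big_ord_recl lerDr.
    by rewrite ltW// ltNge; apply/negP; exact: nB.
  by rewrite phia leye_eq.
(* The added 1 bounds the term k = 0, which [phi] leaves out. *)
- apply: (all_finite_range W1 W_homo (Ordinal hK) (S := 1 + fine (phi a)) hX) => -[|n].
    rewrite big_ord0 addr_ge0// fine_ge0//.
    by apply: nneseries_ge0 => k _ _; rewrite lee_fin; exact: iW0.
  have phi0 : (0 <= phi a)%E by apply: nneseries_ge0 => k _ _; rewrite lee_fin; exact: iW0.
  rewrite big_ord_recl lerD//; first by rewrite invf_le1// (lt_le_trans _ (W1 _)).
  rewrite -lee_fin fineK ?ge0_fin_numE// -sumW.
  by apply: nneseries_lim_ge => k _ _; rewrite lee_fin; exact: iW0.
Qed.
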